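(* Let $\mathcal{CL}\subset\mathbb{P}^2_{\mathbb{C}}$ be an $\mathscr{M}$-arrangement of $d\geq 3$ lines and one smooth conic with only ordinary singularities of multiplicity at most $4$. For $r\in\{2,3,4\}$ let $n_r$ denote the number of points of $\mathbb{P}^2_{\mathbb{C}}$ lying on exactly $r$ curves of $\mathcal{CL}$. (i) If $d=2\ell\geq 4$, then $n_2+n_3=3\ell-6$ and $n_3+3n_4=\ell^2+3$. (ii) If $d=2\ell+1\geq 3$, then $n_2+n_3=3\ell-2$ and $n_3+3n_4=\ell^2+\ell+2$.
   Context: An arrangement of conics and lines is a finite set of pairwise distinct smooth conics and lines in $\mathbb{P}^2_{\mathbb{C}}$, identified with the reduced curve $\{f=0\}$ that is their union; with one conic and $d$ lines its degree is $d+2$. A singular point of this curve is ordinary of multiplicity $r$ if exactly $r$ curves of the arrangement pass through it and their tangent lines there are pairwise distinct. For a reduced curve $C=\{f=0\}$, $J_f=\langle\partial_x f,\partial_y f,\partial_z f\rangle$ is the Jacobian ideal, and $\deg J_f$ is the degree of the scheme it defines, i.e. the total Tjurina number $\tau(C)=\sum_{p\in\mathrm{Sing}(C)}\tau_p$. (An ordinary point of multiplicity $r\le 4$ has $\tau_p=(r-1)^2$.) An arrangement of degree $e\geq 5$ with only ordinary singularities of multiplicity at most $4$ is an $\mathscr{M}$-arrangement (its union is an $\mathscr{M}$-curve) if it has at least one ordinary quadruple point and $$\deg J_f=\begin{cases}3m^2-3m+3 & \text{if } e=2m\geq 6,\\ 3m^2+1 & \text{if } e=2m+1\geq 5.\end{cases}$$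 *)

(* Defs.v *)
From HB Require Import structures.
From mathcomp Require Import all_boot all_order all_algebra.
From mathcomp Require Import fraction complex mpoly finmap.
From mathcomp Require Import boolp classical_sets functions cardinality.
From mathcomp Require Import fsbigop reals.

Set Implicit Arguments.
Unset Strict Implicit.
Unset Printing Implicit Defensive.

Import GRing.Theory.
Local Open Scope classical_set_scope.
Local Open Scope ring_scope.

Section ProjectivePlane.
Variable K : numClosedFieldType.

(* Points of P^2 are the one-dimensional subspaces of K^3. *)
Definition proj_plane := {U : {vspace 'rV[K]_3} | \dim U == 1%N}.

Definition hcoord (p : proj_plane) (i : 'I_3) : K := vpick (val p) ord0 i.

(* Only applied to homogeneous polynomials, for which the answer does not
   depend on the choice of homogeneous coordinates. *)
Definition vanishes (f : {mpoly K[3]}) (p : proj_plane) : bool :=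
  f.@[hcoord p] == 0.

Definition zero_locus (f : {mpoly K[3]}) : set proj_plane :=
  [set p | vanishes f p].

(* By Euler's formula the partial derivatives of a homogeneous polynomial of
   positive degree have no common zero outside the curve. *)
Definition Sing (f : {mpoly K[3]}) : set proj_plane :=
  [set p | forall i : 'I_3, vanishes (mderiv i f) p].

Definition is_line (g : {mpoly K[3]}) : Prop :=
  g \is 1.-homog /\ g != 0.

Definition is_smooth_conic (g : {mpoly K[3]}) : Prop :=
  g \is 2.-homog /\ Sing g = set0.

(* The projective tangent line at p to a curve g = 0 that is smooth at p. *)
Definition tangent_line (g : {mpoly K[3]}) (p : proj_plane) :
    set proj_plane :=
  [set q | \sum_(i < 3) (mderiv i g).@[hcoord p] * hcoord q i = 0].

End ProjectivePlane.

Section JacobianScheme.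
Variable K : numClosedFieldType.

Definition jacobian_ideal (f : {mpoly K[3]}) : set {mpoly K[3]} :=
  [set h | exists a : 'I_3 -> {mpoly K[3]},
     h = \sum_(i < 3) a i * mderiv i f].

(* The degree-zero part of the localization, at the homogeneous prime of p, of
   a homogeneous ideal I: the stalk at p of the ideal sheaf defined by I.  For
   I = setT it is the local ring of P^2 at p. *)
Definition stalk (I : set {mpoly K[3]}) (p : proj_plane K) :
    set {fraction {mpoly K[3]}} :=
  [set q | exists k : nat, exists a b : {mpoly K[3]},
     [/\ a \is k.-homog, b \is k.-homog, I a, ~~ vanishes b p
       & q = FracField.tofrac a / FracField.tofrac b]].

Definition scale_frac (c : K) (q : {fraction {mpoly K[3]}}) :
    {fraction {mpoly K[3]}} :=
  FracField.tofrac c%:MP * q.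

(* b induces a basis of the K-vector space V / W, where W `<=` V. *)
Definition quotient_basis (V W : set {fraction {mpoly K[3]}}) (n : nat)
    (b : 'I_n -> {fraction {mpoly K[3]}}) : Prop :=
  (forall i, V (b i)) /\
  (forall v, V v -> exists! c : 'rV[K]_n,
     W (v - \sum_(i < n) scale_frac (c ord0 i) (b i))).

(* dim_K (V / W), with value 0 if V / W is infinite-dimensional. *)
Definition quotient_dim (V W : set {fraction {mpoly K[3]}}) : nat :=
  xget 0%N [set n | exists b, @quotient_basis V W n b].

(* The local Tjurina number: the length at p of the scheme defined by the
   Jacobian ideal of f.  In a chart at p with local equation g, Euler's formula
   identifies the stalk of the Jacobian ideal with (g, g_x, g_y). *)
Definition tjurina (f : {mpoly K[3]}) (p : proj_plane K) : nat :=
  quotient_dim (stalk setT p) (stalk (jacobian_ideal f) p).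

Definition jacobian_degree (f : {mpoly K[3]}) : nat :=
  (\big[addn/0]_(p \in Sing f) tjurina f p)%N.

End JacobianScheme.

Section Arrangement.
Variables (K : numClosedFieldType) (I : finType) (A : I -> {mpoly K[3]}).

Definition is_arrangement : Prop :=
  (forall i, is_line (A i) \/ is_smooth_conic (A i)) /\
  injective (fun i => zero_locus (A i)).

Definition arr_poly : {mpoly K[3]} := \prod_(i : I) A i.

Definition arr_degree : nat := (msize arr_poly).-1.

Definition arr_mult (p : proj_plane K) : nat := #|[set i | vanishes (A i) p]|.

Definition num_points (r : nat) : nat :=
  #|` fset_set [set p : proj_plane K | arr_mult p = r]|.

Definition ordinary_singularity (p : proj_plane K) (r : nat) : Prop :=
  [/\ Sing arr_poly p, arr_mult p = r
    & forall i j, i != j -> vanishes (A i) p -> vanishes (A j) p ->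
        tangent_line (A i) p <> tangent_line (A j) p].

Definition is_M_arrangement : Prop :=
  [/\ is_arrangement,
      (5 <= arr_degree)%N,
      forall p, Sing arr_poly p ->
        exists2 r, (r <= 4)%N & ordinary_singularity p r,
      exists p, ordinary_singularity p 4
    & let m := (arr_degree./2)%N in
      jacobian_degree arr_poly =
        (if odd arr_degree then 3 * m ^ 2 + 1
         else 3 * m ^ 2 - 3 * m + 3)%N].

End Arrangement.

(* Main.v *)
(* Two lines meet in one point, and a line meets the conic in two because no
   ordinary point is a point of tangency.  Counting the pairs of curves through
   each multiple point hence gives n2 + 3 n3 + 6 n4 = d (d - 1) / 2 + 2 d.  The
   degree of the Jacobian scheme is n2 + 4 n3 + 9 n4, as an ordinary point of
   multiplicity r <= 4 has Tjurina number (r - 1)^2, and the theorem follows by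
   solving these two equations.

   For the Tjurina number put s = r - 1 and take affine coordinates x, y at the
   point.  The initial forms of the two partial derivatives in the directions x
   and y are the partial derivatives, of degree s, of the tangent cone; since
   the tangent cone has r distinct roots, they have no syzygy with coefficients
   of degree < s.  By a dimension count they generate all forms of degree
   2 s - 1, so by Nakayama the Jacobian ideal contains the (2 s - 1)-st power of
   the maximal ideal.  The third partial derivative is redundant modulo this
   power by Euler's formula, because 2 s - 1 <= r + 1.  Counting dimensions of
   jets, the length is s (2 s - 1) - s (s - 1) = s^2. *)
Require Import Defs.
From HB Require Import structures.
From mathcomp Require Import all_boot all_order all_algebra.
From mathcomp Require Import fraction complex mpoly finmap.
From mathcomp Require Import boolp classical_sets cardinality.
From mathcomp Require Import fsbigop reals.
From mathcomp Require Import ring zify.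

Set Implicit Arguments.
Unset Strict Implicit.
Unset Printing Implicit Defensive.

Import GRing.Theory Num.Theory.
Local Open Scope ring_scope.

(** The Tjurina number is the dimension of a quotient between two sets of fractions of forms, so the
    local analysis is carried by forms and their truncated expansions. The substitution [x = tau t],
    [y = tau] turns a binary form of degree [k] into a polynomial in [t] of degree at most [k],
    times [tau^k]. Jets become triangular tables of coefficients, syzygies of initial forms become
    relations between univariate polynomials, and the dimension count becomes the invertibility of a
    Sylvester matrix. The price is that the direction [y = 0] sits at [t = infinity]. The frame at
    the point is therefore chosen with its first vector off every tangent line, so that all tangents
    are finite roots of the tangent cone. An expansion decides membership only modulo the [N]-th
    power of the ideal of the point, whereas membership in a stalk asks for one numerator in the
    Jacobian ideal over one homogeneous denominator. So the Nakayama step must produce an actual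
    form, nonzero at the point, that multiplies this power into the Jacobian ideal; a determinant
    provides it. *)

(** * Homogeneous polynomials *)

Section Homogeneous.
Variables (n : nat) (K : numFieldType).
Implicit Types (f g : {mpoly K[n]}) (x y : 'I_n -> K).

Lemma dhomog_prodr (I : finType) (P : pred I) (D : I -> nat) (f : I -> {mpoly K[n]}) :
  (forall i, P i -> f i \is (D i).-homog) ->
  \prod_(i | P i) f i \is (\sum_(i | P i) D i)%N.-homog.
Proof.
move=> hf; elim/big_rec2: _ => [|i k g Pi hg]; first exact: dhomog1.
exact: dhomogM (hf i Pi) hg.
Qed.

Lemma dhomogXU (i : 'I_n) : ('X_i : {mpoly K[n]}) \is 1.-homog.
Proof. by rewrite dhomogX /= mdeg1. Qed.

Lemma dhomog_mderiv i k f : f \is k.-homog -> mderiv i f \is k.-1.-homog.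
Proof.
move=> hf; apply/dhomogP => m; rewrite mcoeff_msupp mcoeff_mderiv => nz.
have : f@_(m + U_(i)) != 0 by apply: contraNneq nz => ->; rewrite mul0rn.
by rewrite -mcoeff_msupp => /(dhomog_mf hf) <- /=; rewrite mdegD mdeg1 addn1.
Qed.

Lemma euler k f : f \is k.-homog -> \sum_i 'X_i * mderiv i f = f *+ k.
Proof.
move=> hf; rewrite {2}[f]mpolyE -sumrMnl.
transitivity (\sum_i \sum_(m <- msupp f) (f@_m *: 'X_[m]) *+ m i).
  apply: eq_bigr => i _; rewrite {1}[f]mpolyE raddf_sum mulr_sumr.
  apply: eq_bigr => m _ /=; rewrite mderivZ mderivX -scalerAr -scalerAr -mpolyXD.
  have [->|mi] := posnP (m i); first by rewrite scale0r scaler0 mulr0n.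
  rewrite addmC submK ?scaler_nat ?scalerMnr //.
  by apply/mnm_lepP => j; rewrite mnm1E; case: eqP => [<-|].
rewrite exchange_big /= big_seq [RHS]big_seq; apply: eq_bigr => m hm.
by rewrite sumrMnr -mdegE -(dhomog_mf hf hm).
Qed.

Lemma euler_eval k f x : f \is k.-homog ->
  \sum_i x i * (mderiv i f).@[x] = f.@[x] *+ k.
Proof.
move=> hf; rewrite -mevalMn -(euler hf) raddf_sum.
by apply: eq_bigr => i _; rewrite /= mevalM mevalXU.
Qed.

Lemma dhomog0_const f : f \is 0.-homog -> f = (f@_0)%:MP.
Proof.
move=> hf; apply: msize1_polyC; rewrite msizeE; apply/bigmax_leqP_seq => m hm _.
by rewrite (dhomog_mf hf hm).
Qed.

(** In characteristic zero Euler's formula can be divided by the degree, which writes a form of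
    degree [k.+1] as a sum of variables times forms of degree [k]. *)
Lemma dhomog_ind (P : nat -> {mpoly K[n]} -> Prop) :
  (forall c, P 0%N c%:MP) ->
  (forall k, P k 0) ->
  (forall k f g, P k f -> P k g -> P k (f + g)) ->
  (forall k i f, f \is k.-homog -> P k f -> P k.+1 ('X_i * f)) ->
  forall k f, f \is k.-homog -> P k f.
Proof.
move=> P0 Pz PD PX; elim=> [|k IHk] f hf; first by rewrite (dhomog0_const hf).
have -> : f = \sum_i 'X_i * (k.+1%:R^-1 *: mderiv i f).
  apply: (@scalerI _ _ k.+1%:R); first by rewrite pnatr_eq0.
  rewrite scaler_nat -(euler hf) scaler_sumr; apply: eq_bigr => i _.
  by rewrite -scalerAr scalerA mulfV ?scale1r ?pnatr_eq0.
apply: (big_ind (P k.+1)) => // [g h|i _]; first exact: PD.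
have hd : k.+1%:R^-1 *: mderiv i f \is k.-homog.
  by rewrite rpredZ ?(dhomog_mderiv i hf).
exact: PX (IHk _ hd).
Qed.

Lemma meval_scale k f c x : f \is k.-homog ->
  f.@[fun i => c * x i] = c ^+ k * f.@[x].
Proof.
elim/dhomog_ind: k f / => [a|k|k f g hf hg|k i f _ hf].
- by rewrite !mevalC mul1r.
- by rewrite !meval0 mulr0.
- by rewrite !mevalD hf hg mulrDr.
- by rewrite !mevalM hf !mevalXU exprS mulrACA.
Qed.

Lemma linear_form_eval f x : f \is 1.-homog ->
  f.@[x] = \sum_i x i * f@_U_(i).
Proof.
move=> hf; rewrite -[LHS]mulr1n -(euler_eval x hf); apply: eq_bigr => i _.
rewrite (dhomog0_const (dhomog_mderiv i hf)) mevalC mcoeff_mderiv add0m.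
by rewrite mnmE mulr1n.
Qed.

(** The polar form [B] is bilinear, is symmetric because second derivatives commute, and satisfies
    [B u u = 2 f(u)]; the formula is the expansion of [B] divided by 2. *)
Lemma quadratic_form_eval f x y c : f \is 2.-homog ->
  f.@[fun i => x i + c * y i] =
  f.@[x] + c * (\sum_i (mderiv i f).@[x] * y i) + c ^+ 2 * f.@[y].
Proof.
move=> hf; pose B u w := \sum_i u i * (mderiv i f).@[w].
have hB u w : B u w = \sum_i \sum_j u i * w j * (mderiv i f)@_U_(j).
  apply: eq_bigr => i _; rewrite linear_form_eval ?(dhomog_mderiv i hf) //.
  by rewrite mulr_sumr; apply: eq_bigr => j _; rewrite mulrA.
have BC u w : B u w = B w u.
  rewrite !hB exchange_big; apply: eq_bigr => i _; apply: eq_bigr => j _.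
  rewrite [w i * _]mulrC; congr (_ * _); rewrite !mcoeff_mderiv addmC.
  by rewrite !mnm1E eq_sym.
have BD u w w' : B u (fun i => w i + c * w' i) = B u w + c * B u w'.
  rewrite !hB mulr_sumr -big_split; apply: eq_bigr => i _ /=.
  by rewrite mulr_sumr -big_split; apply: eq_bigr => j _ /=; ring.
have e u : f.@[u] *+ 2 = B u u by rewrite -(euler_eval u hf).
apply: (mulIf (_ : 2%:R != 0)); first by rewrite pnatr_eq0.
rewrite !mulrDl -!mulrA !mulr_natr !e BD (BC _ x) (BC _ y) !BD.
have -> : \sum_i (mderiv i f).@[x] * y i = B y x.
  by apply: eq_bigr => i _; rewrite mulrC.
by rewrite [B x y]BC; ring.
Qed.

End Homogeneous.

(** * Dimensions of quotients *)

Section QuotientDim.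
Variables (K : numClosedFieldType) (U : vectType K) (U0 : {vspace U}).

(** Uniqueness makes the combination map [L] injective with image meeting [U0] in zero; existence
    makes that image and [U0] span everything. *)
Lemma dim_complement_family (m : nat) (u : 'I_m -> U) :
  (forall w, exists! c : 'rV[K]_m, w - \sum_i c ord0 i *: u i \in U0) ->
  m = (\dim {:U} - \dim U0)%N.
Proof.
move=> hu; pose L (c : 'rV[K]_m) := \sum_i c ord0 i *: u i.
have L_lin : linear L.
  move=> a c c'; rewrite /L scaler_sumr -big_split; apply: eq_bigr => i _ /=.
  by rewrite !mxE scalerDl scalerA.
pose LL : {linear 'rV[K]_m -> U} :=
  HB.pack L (GRing.isLinear.Build K 'rV[K]_m U _ L L_lin).
have LE c : linfun LL c = L c by rewrite lfunE.
have L_inj c : L c \in U0 -> c = 0.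
  move=> hc; have [c0 [_ uniq0]] := hu 0.
  have e1 : c0 = 0.
    by apply: uniq0; rewrite big1 ?subr0 ?mem0v // => i _; rewrite mxE scale0r.
  suff : c0 = - c by rewrite e1 => /esym/eqP; rewrite oppr_eq0 => /eqP.
  apply: uniq0; rewrite (_ : \sum_i _ = - L c) ?opprK ?add0r //.
  by rewrite -sumrN; apply: eq_bigr => i _; rewrite mxE scaleNr.
have ker0 : ({:'rV[K]_m} :&: lker (linfun LL) = 0)%VS.
  apply/eqP; rewrite -subv0; apply/subvP => c; rewrite memv_cap memv_ker LE.
  by case/andP => _ /eqP h; rewrite memv0; apply/eqP/L_inj; rewrite h mem0v.
have dimL : \dim (limg (linfun LL)) = m.
  by rewrite (limg_dim_eq ker0) dimvf /dim /= mul1n.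
have cap0 : (limg (linfun LL) :&: U0 = 0)%VS.
  apply/eqP; rewrite -subv0; apply/subvP => w; rewrite memv_cap => /andP[].
  case/memv_imgP => c _ ->; rewrite LE => /L_inj ->.
  by rewrite memv0 -LE linear0.
have sumT : (limg (linfun LL) + U0 = fullv)%VS.
  apply/eqP; rewrite eqEsubv subvf /=; apply/subvP => w _.
  have [c [hc _]] := hu w; apply/memv_addP.
  exists (L c); first by rewrite -LE memv_img ?memvf.
  by exists (w - L c); rewrite // addrC subrK.
by rewrite -sumT dimv_disjoint_sum // dimL addnK.
Qed.

Variables (V W : set {fraction {mpoly K[3]}}).
(** [rho] stands for the graph of a linear surjection from [V] to [U] under which [W] is the
    preimage of [U0]. As a relation it needs neither a choice of representatives nor a vector space
    structure on the set [V]. *)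
Variable rho : {fraction {mpoly K[3]}} -> U -> Prop.
Hypothesis rhoV : forall q u, rho q u -> V q.
Hypothesis rho_total : forall q, V q -> exists u, rho q u.
Hypothesis rho_surj : forall u, exists q, rho q u.
Hypothesis rho_lin : forall c q q' u u', rho q u -> rho q' u' ->
  rho (q - scale_frac c q') (u - c *: u').
Hypothesis rho_ker : forall q u, rho q u -> W q <-> u \in U0.

Lemma rho_sum (m : nat) (c : 'I_m -> K) q u b w :
  rho q u -> (forall i, rho (b i) (w i)) ->
  rho (q - \sum_(i < m) scale_frac (c i) (b i)) (u - \sum_(i < m) c i *: w i).
Proof.
move=> hq; elim: m c b w => [|m IHm] c b w hb; first by rewrite !big_ord0 !subr0.
rewrite !big_ord_recr /= !opprD !addrA.
by apply: rho_lin (hb _); apply: IHm.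
Qed.

Lemma quotient_basisE (m : nat) (b : 'I_m -> {fraction {mpoly K[3]}}) w :
  (forall i, rho (b i) (w i)) ->
  quotient_basis V W b <->
  (forall u, exists! c : 'rV[K]_m, u - \sum_i c ord0 i *: w i \in U0).
Proof.
move=> hb; split=> [[_ hV] u|hw].
  have [q hq] := rho_surj u; have [c [h1 h2]] := hV q (rhoV hq).
  exists c; split=> [|c' hc']; first exact/(rho_ker (rho_sum _ hq hb)).
  exact/h2/(rho_ker (rho_sum _ hq hb)).
split=> [i|q /rho_total [u hq]]; first exact: rhoV (hb i).
have [c [h1 h2]] := hw u.
exists c; split=> [|c' hc']; first exact/(rho_ker (rho_sum _ hq hb)).
exact/h2/(rho_ker (rho_sum _ hq hb)).
Qed.

(** [quotient_dim] picks some size of a basis and defaults to 0, so both the existence of a basis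
    and the uniqueness of its size are required. *)
Lemma quotient_dimE : quotient_dim V W = (\dim {:U} - \dim U0)%N.
Proof.
apply: xget_unique; last first.
  move=> m [b hb]; have [w hw] := choice (fun i => rho_total (hb.1 i)).
  exact: dim_complement_family ((quotient_basisE hw).1 hb).
(* Existence: a basis of a complement of [U0], lifted through [rho]. *)
rewrite -dimv_compl; set C := (U0^C)%VS; pose e := vbasis C.
have [b hb] := choice (fun i : 'I_(\dim C) => rho_surj e`_i).
exists b; apply/(quotient_basisE hb) => u.
have : u \in (U0 + C)%VS by rewrite addv_complf memvf.
case/memv_addP => u0 hu0 [u1 hu1 ->].
exists (\row_i coord e i u1); split=> [|c].
  rewrite (eq_bigr (fun i : 'I_(\dim C) => coord e i u1 *: e`_i)).
    by rewrite -coord_vbasis ?addrK.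
  by move=> i _; rewrite mxE.
set s := \sum_i _ => hs.
have sC : s \in C.
  by apply: memv_suml => i _; rewrite memvZ ?vbasis_mem ?memt_nth.
have : u1 - s \in (U0 :&: C)%VS.
  rewrite memv_cap [in X in _ && X]rpredB // andbT.
  by rewrite -(rpredDl _ hu0) addrA.
rewrite capv_compl memv0 subr_eq0 => /eqP ->.
by apply/rowP => i; rewrite mxE coord_sum_free ?(basis_free (vbasisP C)).
Qed.

End QuotientDim.

(** * The blow-up chart at a point *)

Lemma mpoly_ring_ind (n : nat) (A : nzRingType) (P : {mpoly A[n]} -> Prop) :
  (forall c, P c%:MP) -> (forall i, P 'X_i) ->
  (forall f g, P f -> P g -> P (f + g)) ->
  (forall f g, P f -> P g -> P (f * g)) -> forall f, P f.
Proof.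
move=> PC PX PD PM; elim/mpolyind => [|c m f _ _ hf]; first by rewrite -mpolyC0.
apply: PD hf; rewrite -mul_mpolyC; apply: (PM) => //.
rewrite mpolyXE_id; apply: (big_ind P); [exact: PC|exact: PM|move=> i _].
by elim: (m i) => [|k IH]; [exact: PC|rewrite exprS; apply: PM].
Qed.

Local Notation o0 := (@Ordinal 3 0 isT).
Local Notation o1 := (@Ordinal 3 1 isT).
Local Notation o2 := (@Ordinal 3 2 isT).

Lemma big_ord3 (A : zmodType) (f : 'I_3 -> A) :
  \sum_i f i = f o0 + f o1 + f o2.
Proof.
rewrite !big_ord_recr big_ord0 /= add0r.
by congr (f _ + f _ + f _); apply: val_inj.
Qed.

(* Polynomials in tau over K[t]; under x = tau t, y = tau the forms of degree k
   in x and y are the monomials p(t) tau^k with [size p <= k.+1]. *)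
Section Blowup.
Variable K : numFieldType.
Implicit Types (p q : {poly {poly K}}).

Definition graded p := forall k, (size (p`_k)%R <= k.+1)%N.

Definition eq_upto (N : nat) p q := forall k, (k < N)%N -> p`_k = q`_k.

Lemma gradedC c : graded c%:P%:P.
Proof.
by move=> k; rewrite coefC; case: k => [|k] /=; rewrite ?size_poly0 ?size_polyC_leq1.
Qed.

Lemma graded0 : graded 0.
Proof. by rewrite -polyC0 -[0]polyC0; apply: gradedC. Qed.

Lemma graded1 : graded 1.
Proof. by rewrite -polyC1 -[1]polyC1; apply: gradedC. Qed.

Lemma gradedD p q : graded p -> graded q -> graded (p + q).
Proof.
move=> hp hq k; rewrite coefD (leq_trans (size_polyD _ _)) //.
by rewrite geq_max hp hq.
Qed.

Lemma gradedM p q : graded p -> graded q -> graded (p * q).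
Proof.
move=> hp hq k; rewrite coefM; apply: (big_ind (fun r : {poly K} => (size r <= k.+1)%N)).
- by rewrite size_poly0.
- by move=> r r' h h'; rewrite (leq_trans (size_polyD _ _)) // geq_max h h'.
move=> i _; rewrite (leq_trans (size_polyMleq _ _)) //.
have := hp i; have := hq (k - i)%N; have := ltn_ord i; lia.
Qed.

Lemma gradedMC c p : graded p -> graded (c%:P%:P * p).
Proof. by move=> hp; apply: gradedM => //; apply: gradedC. Qed.

Lemma graded_sum (I : Type) (r : seq I) (P : pred I) (f : I -> {poly {poly K}}) :
  (forall i, P i -> graded (f i)) -> graded (\sum_(i <- r | P i) f i).
Proof.
move=> hf; apply: big_ind => //; [exact: graded0|exact: gradedD].
Qed.

Lemma gradedX p (k : nat) : graded p -> graded (p ^+ k).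
Proof.
move=> hp; elim: k => [|k IH]; first exact: graded1.
by rewrite exprS; apply: gradedM.
Qed.

Lemma graded_monomial (k : nat) (r : {poly K}) :
  (size r <= k.+1)%N -> graded (r%:P * 'X^k).
Proof.
move=> hr j; rewrite coefCM coefXn; case: eqP => [->|_]; rewrite ?mulr1 //.
by rewrite mulr0 size_poly0.
Qed.

Lemma eq_upto_sym N p q : eq_upto N p q -> eq_upto N q p.
Proof. by move=> h k hk; rewrite h. Qed.

Lemma eq_upto_trans N q p r : eq_upto N p q -> eq_upto N q r -> eq_upto N p r.
Proof. by move=> h h' k hk; rewrite h ?h'. Qed.

Lemma eq_uptoD N p q p' q' :
  eq_upto N p q -> eq_upto N p' q' -> eq_upto N (p + p') (q + q').
Proof. by move=> h h' k hk; rewrite !coefD h ?h'. Qed.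

Lemma eq_uptoB N p q p' q' :
  eq_upto N p q -> eq_upto N p' q' -> eq_upto N (p - p') (q - q').
Proof. by move=> h h' k hk; rewrite !coefB h ?h'. Qed.

Lemma eq_uptoM N p q p' q' :
  eq_upto N p q -> eq_upto N p' q' -> eq_upto N (p * p') (q * q').
Proof.
move=> h h' k hk; rewrite !coefM; apply: eq_bigr => i _.
by rewrite h ?h' //; have := ltn_ord i; lia.
Qed.

Lemma eq_upto_cancel N (r : {poly {poly K}}) p q (c : K) : c != 0 -> r`_0 = c%:P ->
  eq_upto N (p * r) (q * r) -> eq_upto N p q.
Proof.
move=> c0 r0 h k; elim/ltn_ind: k => k IH hk.
have := h k hk; rewrite !coefM !big_ord_recr /= !subnn !r0.
rewrite (eq_bigr (fun i : 'I_k => q`_i * r`_(k - i))) => [/addrI|i _].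
  by move/mulIf; apply; rewrite polyC_eq0.
by rewrite IH //; have := ltn_ord i; lia.
Qed.

(** The truncated geometric series of [d = 1 - r / c], which is divisible by [tau]. The constant
    term must be a scalar, not just a nonzero polynomial in [t], for the inverse to exist and to be
    graded. *)
Lemma inverse_upto N (r : {poly {poly K}}) (c : K) : c != 0 -> r`_0 = c%:P -> graded r ->
  exists2 r', graded r' & eq_upto N (r' * r) 1.
Proof.
move=> c0 r0 gr; pose d := 1 - c^-1%:P%:P * r.
have gd : graded d.
  apply: gradedD; first exact: graded1.
  by rewrite -mulN1r -polyCN -polyCN -[X in X%:P%:P]mulr1; do !apply: gradedMC.
exists (c^-1%:P%:P * \sum_(i < N) d ^+ i).
  by apply: gradedMC; apply: graded_sum => i _; apply: gradedX.
rewrite mulrAC (_ : c^-1%:P%:P * r = 1 - d); last by rewrite /d opprB addrC subrK.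
have -> : (1 - d) * \sum_(i < N) d ^+ i = 1 - d ^+ N.
  rewrite -[X in _ = X - _](expr1n _ N) subrXX; congr (_ * _).
  by apply: eq_bigr => i _; rewrite expr1n mul1r.
have d0 : d`_0 = 0.
  by rewrite /d coefB coefC coefCM r0 -polyCM mulVf ?subrr.
move=> k hk; rewrite coefB (_ : (d ^+ N)`_k = 0) ?subr0 //.
elim/poly_ind: (d) d0 => [|d' a _].
  by rewrite expr0n (gtn_eqF (leq_ltn_trans _ hk)) ?coef0.
rewrite coefD coefMX coefC add0r => ->.
by rewrite polyC0 addr0 exprMn coefMXn hk.
Qed.

End Blowup.

(* The point v + tau (t e1 + e2), where e1, e2, v are the rows of E. *)
Definition blowup_coord (K : numFieldType) (E : 'M[K]_3) (i : 'I_3) : {poly {poly K}} :=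
  (E o2 i)%:P%:P + 'X * ('X * (E o0 i)%:P + (E o1 i)%:P)%:P.

HB.lock Definition blowup (K : numFieldType) (E : 'M[K]_3) (f : {mpoly K[3]})
  : {poly {poly K}} := mmap (polyC \o polyC) (blowup_coord E) f.

HB.lock Definition dirder (K : numFieldType) (E : 'M[K]_3) (j : 'I_3) (f : {mpoly K[3]})
  : {mpoly K[3]} := \sum_i E j i *: mderiv i f.

Section Chart.
Variables (K : numFieldType) (E : 'M[K]_3).
Implicit Types (f g : {mpoly K[3]}).

Local Notation bl := (blowup E).
Local Notation dir := (dirder E).

Lemma blowupC c : bl c%:MP = c%:P%:P.
Proof. by rewrite blowup.unlock mmapC. Qed.

Lemma blowupXU i : bl 'X_i = blowup_coord E i.
Proof. by rewrite blowup.unlock mmapX mmap1U. Qed.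

Lemma blowupD f g : bl (f + g) = bl f + bl g.
Proof. by rewrite blowup.unlock rmorphD. Qed.

Lemma blowupM f g : bl (f * g) = bl f * bl g.
Proof. by rewrite blowup.unlock rmorphM. Qed.

Lemma blowup0 : bl 0 = 0.
Proof. by rewrite blowup.unlock rmorph0. Qed.

Lemma blowup1 : bl 1 = 1.
Proof. by rewrite blowup.unlock rmorph1. Qed.

Lemma blowupXn f k : bl (f ^+ k) = bl f ^+ k.
Proof. by rewrite blowup.unlock rmorphXn. Qed.

Lemma blowupB f g : bl (f - g) = bl f - bl g.
Proof. by rewrite blowup.unlock rmorphB. Qed.

Lemma blowupZ c f : bl (c *: f) = c%:P%:P * bl f.
Proof. by rewrite blowup.unlock mmapZ. Qed.

Lemma blowup_sum (I : Type) (r : seq I) (P : pred I) (F : I -> {mpoly K[3]}) :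
  bl (\sum_(i <- r | P i) F i) = \sum_(i <- r | P i) bl (F i).
Proof. by rewrite blowup.unlock rmorph_sum. Qed.

Lemma graded_blowup f : graded (bl f).
Proof.
elim/mpoly_ring_ind: f => [c|i|f g hf hg|f g hf hg].
- by rewrite blowupC; apply: gradedC.
- rewrite blowupXU; apply: gradedD; first exact: gradedC.
  rewrite mulrC; apply: (@graded_monomial _ 1).
  rewrite (leq_trans (size_polyD _ _)) // geq_max (leq_trans (size_polyC_leq1 _)) //.
  rewrite (leq_trans (size_polyMleq _ _)) // size_polyX.
  by have := size_polyC_leq1 (E o0 i); lia.
- by rewrite blowupD; apply: gradedD.
- by rewrite blowupM; apply: gradedM.
Qed.

Lemma coef0_blowup f : (bl f)`_0 = (f.@[E o2])%:P.
Proof.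
elim/mpoly_ring_ind: f => [c|i|f g hf hg|f g hf hg].
- by rewrite blowupC mevalC coefC.
- by rewrite blowupXU mevalXU coefD coefC coef0M coefX mul0r addr0.
- by rewrite blowupD coefD mevalD hf hg polyCD.
- by rewrite blowupM coef0M mevalM hf hg polyCM.
Qed.

(** The chain rule for any derivation over [K]. It serves twice: for the derivative in [tau], and
    for the coefficientwise derivative in [t]. *)
Lemma blowup_derivation (d : {poly {poly K}} -> {poly {poly K}}) :
  {morph d : p q / p + q} -> (forall p q, d (p * q) = d p * q + p * d q) ->
  (forall c, d c%:P%:P = 0) ->
  forall f, d (bl f) = \sum_i bl (mderiv i f) * d (blowup_coord E i).
Proof.
move=> dD dM dC; elim/mpoly_ring_ind => [c|j|f g hf hg|f g hf hg].
- by rewrite blowupC dC big1 // => i _; rewrite mderivC blowup0 mul0r.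
- rewrite blowupXU (bigD1 j) //= big1 => [|i hi].
    have U0 : (U_(j) - U_(j))%MM = 0%MM by apply/mnmP => k; rewrite mnmBE mnm0E subnn.
    by rewrite mderivX mnm1E eqxx scale1r U0 mpolyX0 blowup1 mul1r addr0.
  by rewrite mderivX mnm1E eq_sym (negbTE hi) scale0r blowup0 mul0r.
- rewrite blowupD dD hf hg -big_split; apply: eq_bigr => i _ /=.
  by rewrite mderivD blowupD mulrDl.
- rewrite blowupM dM hf hg mulr_suml mulr_sumr -big_split; apply: eq_bigr => i _ /=.
  by rewrite mderivM blowupD !blowupM; ring.
Qed.

Lemma blowup_dirder j f :
  bl (dir j f) = \sum_i bl (mderiv i f) * (E j i)%:P%:P.
Proof.
rewrite dirder.unlock blowup_sum.
by apply: eq_bigr => i _; rewrite blowupZ mulrC.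
Qed.

Lemma deriv_blowup f :
  deriv (bl f) = 'X%:P * bl (dir o0 f) + bl (dir o1 f).
Proof.
rewrite (@blowup_derivation deriv) => [|p q|p q|c]; last 3 first.
- exact: derivD.
- exact: derivM.
- exact: derivC.
rewrite !blowup_dirder mulr_sumr -big_split; apply: eq_bigr => i _ /=.
rewrite derivD derivC derivM derivX derivC mul1r mulr0 addr0 add0r.
by rewrite polyCD polyCM; ring.
Qed.

Lemma coefwise_deriv_blowup f : map_poly deriv (bl f) = 'X * bl (dir o0 f).
Proof.
have cE (p : {poly {poly K}}) k : (map_poly deriv p)`_k = deriv p`_k.
  by rewrite coef_map_id0 ?deriv0.
rewrite (@blowup_derivation (map_poly deriv)) => [|p q|p q|c]; last 3 first.
- by apply/polyP => k; rewrite coefD !cE coefD derivD.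
- apply/polyP => k; rewrite coefD !coefM cE coefM raddf_sum -big_split.
  by apply: eq_bigr => i _ /=; rewrite !cE derivM.
- by apply/polyP => k; rewrite cE coef0 coefC; case: eqP => _; rewrite ?derivC ?deriv0.
rewrite !blowup_dirder mulr_sumr; apply: eq_bigr => i _ /=.
rewrite [RHS]mulrCA; congr (_ * _); apply/polyP => k.
rewrite cE !coefD coefC coefXM coefC coefXM coefC.
case: k => [|k] /=; first by rewrite addr0 derivC.
case: k => [|k] /=; last by rewrite addr0 deriv0.
by rewrite add0r derivD derivM derivX !derivC mulr0 addr0 mul1r addr0.
Qed.

Lemma coef_blowup_dirder0 f k :
  (bl (dir o0 f))`_k = ((bl f)`_k.+1)^`().
Proof.
have := congr1 (fun p : {poly {poly K}} => p`_k.+1) (coefwise_deriv_blowup f).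
by rewrite coefXM coef_map_id0 ?deriv0.
Qed.

(** Euler's relation for a binary form of degree [k.+1], read at [y = 1]: the derivative in [y] is
    [k.+1] times the form minus [t] times the derivative in [x]. *)
Lemma coef_blowup_dirder1 f k :
  (bl (dir o1 f))`_k =
  (bl f)`_k.+1 *+ k.+1 - 'X * ((bl f)`_k.+1)^`().
Proof.
have := congr1 (fun p : {poly {poly K}} => p`_k) (deriv_blowup f).
rewrite coef_deriv coefD coefCM coef_blowup_dirder0 => ->.
by rewrite addrC addKr.
Qed.

Hypothesis E_unit : E \in unitmx.

(** The basis of linear forms dual to the rows of [E]. The last one is 1 at the base point [E o2]
    and is the denominator of the affine chart. *)
Definition coord_form (j : 'I_3) : {mpoly K[3]} := \sum_i (invmx E) i j *: 'X_i.

Lemma coord_form_homog j : coord_form j \is 1.-homog.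
Proof. by apply: rpred_sum => i _; rewrite rpredZ ?dhomogXU. Qed.

Lemma XU_coord_form i : 'X_i = \sum_j E j i *: coord_form j :> {mpoly K[3]}.
Proof.
under eq_bigr do rewrite scaler_sumr; rewrite exchange_big (bigD1 i) //=.
rewrite [X in _ + X]big1 ?addr0 => [|k hk]; last first.
  under eq_bigr do rewrite scalerA mulrC; rewrite -scaler_suml.
  have := mulVmx E_unit => /matrixP/(_ k i); rewrite !mxE (negbTE hk) => ->.
  by rewrite scale0r.
under eq_bigr do rewrite scalerA mulrC; rewrite -scaler_suml.
by have := mulVmx E_unit => /matrixP/(_ i i); rewrite !mxE eqxx => ->; rewrite scale1r.
Qed.

Lemma mderiv_dirder i f : mderiv i f = \sum_j invmx E i j *: dir j f.
Proof.
rewrite dirder.unlock.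
under eq_bigr do rewrite scaler_sumr; rewrite exchange_big (bigD1 i) //=.
rewrite [X in _ + X]big1 ?addr0 => [|k hk]; last first.
  under eq_bigr do rewrite scalerA; rewrite -scaler_suml.
  have := mulVmx E_unit => /matrixP/(_ i k); rewrite !mxE eq_sym (negbTE hk) => ->.
  by rewrite scale0r.
under eq_bigr do rewrite scalerA; rewrite -scaler_suml.
by have := mulVmx E_unit => /matrixP/(_ i i); rewrite !mxE eqxx => ->; rewrite scale1r.
Qed.

Lemma dirder_homog j k f : f \is k.-homog -> dir j f \is k.-1.-homog.
Proof.
move=> hf; rewrite dirder.unlock.
by apply: rpred_sum => i _; rewrite rpredZ ?dhomog_mderiv.
Qed.

Lemma meval_coord_form j k : (coord_form j).@[E k] = (k == j)%:R.
Proof.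
rewrite raddf_sum /=; have := mulmxV E_unit => /matrixP/(_ k j); rewrite !mxE => <-.
by apply: eq_bigr => i _; rewrite mevalZ mevalXU mulrC.
Qed.

Lemma blowup_coord_form j :
  bl (coord_form j) =
  (j == o2)%:R + 'X * ('X * (j == o0)%:R + (j == o1)%:R)%:P.
Proof.
have h k := meval_coord_form j k; have {}h k : \sum_i invmx E i j * E k i = (k == j)%:R.
  by rewrite -h raddf_sum /=; apply: eq_bigr => i _; rewrite mevalZ mevalXU.
rewrite blowup_sum; under eq_bigr do rewrite blowupZ blowupXU mulrDr.
rewrite big_split /=; congr (_ + _).
  under eq_bigr do rewrite -!polyCM; rewrite -!rmorph_sum h eq_sym.
  by case: eqP => _; rewrite ?polyC0 ?polyC1.
under eq_bigr do rewrite mulrCA; rewrite -mulr_sumr; congr (_ * _).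
under eq_bigr do rewrite -polyCM; rewrite -rmorph_sum; congr (_%:P).
under eq_bigr do rewrite mulrDr mulrCA -!polyCM.
rewrite big_split /= -mulr_sumr -!rmorph_sum !h !(eq_sym j).
by do 2!case: eqP => _; rewrite ?polyC0 ?polyC1.
Qed.

Lemma blowup_coord_form0 : bl (coord_form o0) = 'X * 'X%:P.
Proof. by rewrite blowup_coord_form /= add0r mulr1 addr0. Qed.

Lemma blowup_coord_form1 : bl (coord_form o1) = 'X.
Proof. by rewrite blowup_coord_form /= add0r mulr0 add0r mulr1. Qed.

Lemma blowup_coord_form2 : bl (coord_form o2) = 1.
Proof. by rewrite blowup_coord_form /= mulr0 addr0 mulr0 addr0. Qed.

Lemma euler_blowup k f : f \is k.-homog ->
  'X * 'X%:P * bl (dir o0 f) + 'X * bl (dir o1 f)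
    + bl (dir o2 f) = bl f *+ k.
Proof.
move=> hf.
rewrite -[X in _ + X]mul1r -{1}blowup_coord_form0 -{1}blowup_coord_form1.
rewrite -blowup_coord_form2 -!blowupM -!blowupD -(big_ord3 (fun j => coord_form j * dir j f)).
rewrite -mulr_natl -!polyC_natr -blowupZ scaler_nat -(euler hf); congr bl.
under [RHS]eq_bigr => i _ do rewrite XU_coord_form mulr_suml.
rewrite [RHS]exchange_big dirder.unlock; apply: eq_bigr => j _ /=; rewrite mulr_sumr.
by apply: eq_bigr => i _; rewrite -scalerAl -scalerAr.
Qed.

End Chart.

(** * Homogenization in the chart and Nakayama's lemma *)

Section Homogenization.
Variables (K : numFieldType) (E : 'M[K]_3).
Hypothesis E_unit : E \in unitmx.
Implicit Types (f g : {mpoly K[3]}) (p q : {poly {poly K}}).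

Local Notation X := (coord_form E o0).
Local Notation Y := (coord_form E o1).
Local Notation Z := (coord_form E o2).
Local Notation bl := (blowup E).

Definition hom_monomial (D k i : nat) : {mpoly K[3]} :=
  X ^+ i * Y ^+ (k - i) * Z ^+ (D - k).

(** Inverse of the blow-up on forms of degree [D]: the monomial [t^i tau^k] comes from
    [X^i Y^(k-i) Z^(D-k)]. Terms with [k > D] or [i > k] are discarded. *)
Definition homogenize (D : nat) p : {mpoly K[3]} :=
  \sum_(k < D.+1) \sum_(i < k.+1) p`_k`_i *: hom_monomial D k i.

Lemma dhomog_coord_formX j k : coord_form E j ^+ k \is k.-homog.
Proof. by rewrite -[k in k.-homog]mul1n; apply: dhomogMn; apply: coord_form_homog. Qed.

Lemma hom_monomial_homog D k i : (i <= k <= D)%N -> hom_monomial D k i \is D.-homog.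
Proof.
move=> h; have e : (i + (k - i) + (D - k))%N = D by lia.
by rewrite -[X in X.-homog]e; do !apply: dhomogM; apply: dhomog_coord_formX.
Qed.

Lemma blowup_hom_monomial D k i : (i <= k)%N -> bl (hom_monomial D k i) = ('X^i)%:P * 'X^k.
Proof.
move=> ik; rewrite !blowupM !blowupXn blowup_coord_form0 // blowup_coord_form1 //.
rewrite blowup_coord_form2 // expr1n mulr1 exprMn mulrAC -exprD subnKC //.
by rewrite mulrC rmorphXn.
Qed.

Lemma homogenize_homog D p : homogenize D p \is D.-homog.
Proof.
apply: rpred_sum => k _; apply: rpred_sum => i _; rewrite rpredZ //.
by apply: hom_monomial_homog; have := ltn_ord k; have := ltn_ord i; lia.
Qed.

Lemma homogenize_linear D c p q :
  homogenize D (c%:P%:P * p + q) = c *: homogenize D p + homogenize D q.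
Proof.
rewrite /homogenize scaler_sumr -big_split; apply: eq_bigr => k _ /=.
rewrite scaler_sumr -big_split; apply: eq_bigr => i _ /=.
by rewrite scalerA -scalerDl coefD coefCM coefD coefCM.
Qed.

Lemma homogenizeD D p q : homogenize D (p + q) = homogenize D p + homogenize D q.
Proof. by rewrite -[p]mul1r -polyC1 -[1]polyC1 homogenize_linear scale1r polyC1 mul1r. Qed.

Lemma homogenize0 D : homogenize D 0 = 0.
Proof. by apply: big1 => k _; apply: big1 => i _; rewrite !coef0 scale0r. Qed.

Lemma homogenizeZ D c p : homogenize D (c%:P%:P * p) = c *: homogenize D p.
Proof. by rewrite -[_ * p]addr0 homogenize_linear homogenize0 addr0. Qed.

Lemma homogenize_monomial D k i : (i <= k <= D)%N ->
  homogenize D (('X^i)%:P * 'X^k) = hom_monomial D k i.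
Proof.
case/andP=> ik kD; rewrite /homogenize (bigD1 (Ordinal (kD : k < D.+1)%N)) //=.
rewrite [X in _ + X]big1 => [|j /negbTE hj]; last first.
  apply: big1 => a _; rewrite coefCM coefXn -(inj_eq val_inj) /= in hj *.
  by rewrite hj mulr0 coef0 scale0r.
rewrite addr0 (bigD1 (Ordinal (ik : i < k.+1)%N)) //= big1 => [|j /negbTE hj].
  by rewrite addr0 coefCM !coefXn !eqxx mulr1 coefXn eqxx scale1r.
rewrite -(inj_eq val_inj) /= in hj.
by rewrite coefCM !coefXn !eqxx mulr1 coefXn hj scale0r.
Qed.

Lemma coef_blowup_homogenize D p k i : (i <= k <= D)%N ->
  (bl (homogenize D p))`_k`_i = p`_k`_i.
Proof.
case/andP=> ik kD; rewrite blowup_sum coef_sum (bigD1 (Ordinal (kD : k < D.+1)%N)) //=.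
rewrite [X in _ + X]big1 => [|j /negbTE hj]; last first.
  rewrite blowup_sum coef_sum big1 // => a _; rewrite blowupZ coefCM.
  rewrite blowup_hom_monomial -1?ltnS // coefCM coefXn eq_sym.
  by rewrite -(inj_eq val_inj) /= in hj *; rewrite hj !mulr0.
rewrite addr0 blowup_sum !coef_sum (bigD1 (Ordinal (ik : i < k.+1)%N)) //= big1.
  rewrite addr0 blowupZ coefCM blowup_hom_monomial // !coefCM coefXn eqxx mulr1.
  by rewrite coefXn eqxx mulr1.
move=> j /negbTE hj; rewrite -(inj_eq val_inj) /= in hj.
rewrite blowupZ coefCM blowup_hom_monomial -1?ltnS // !coefCM !coefXn eqxx mulr1.
by rewrite coefXn eq_sym hj mulr0.
Qed.

Lemma blowup_homogenize D p k : graded p -> (k <= D)%N ->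
  (bl (homogenize D p))`_k = p`_k.
Proof.
move=> gp kD; apply/polyP => i; have [ik|ki] := leqP i k.
  by rewrite coef_blowup_homogenize ?ik.
rewrite [LHS]nth_default ?[RHS]nth_default //; first exact: leq_trans (gp k) ki.
exact: leq_trans (graded_blowup E _ k) ki.
Qed.

Lemma blowupK D f : f \is D.-homog -> homogenize D (bl f) = f.
Proof.
(* Blowing up recovers the coefficients of [p] that [homogenize] uses, so it is enough that every
   form lies in its image. That image is stable under multiplication by the dual coordinates. *)
move=> hf; have [p ->] : exists p, f = homogenize D p.
  elim/dhomog_ind: D f / hf => [c|D|D f g [p ->] [q ->]|D i f hf [p ->]].
  - exists c%:P%:P; rewrite /homogenize !big_ord1 /hom_monomial !expr0 !mulr1.
    by rewrite !coefC eqxx /= alg_mpolyC.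
  - by exists 0; rewrite homogenize0.
  - by exists (p + q); rewrite homogenizeD.
  rewrite (XU_coord_form E_unit) mulr_suml.
  apply: (big_ind (fun g => exists q, g = homogenize D.+1 q)).
  - by exists 0; rewrite homogenize0.
  - by move=> g h [q ->] [q' ->]; exists (q + q'); rewrite homogenizeD.
  move=> j _; rewrite -scalerAl mulr_sumr scaler_sumr.
  apply: (big_ind (fun g => exists q, g = homogenize D.+1 q)).
  - by exists 0; rewrite homogenize0.
  - by move=> g h [q ->] [q' ->]; exists (q + q'); rewrite homogenizeD.
  move=> k _; rewrite mulr_sumr scaler_sumr.
  apply: (big_ind (fun g => exists q, g = homogenize D.+1 q)).
  - by exists 0; rewrite homogenize0.
  - by move=> g h [q ->] [q' ->]; exists (q + q'); rewrite homogenizeD.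
  move=> l _; rewrite -scalerAr scalerA.
  set c := _ * _; clearbody c; have lk : (l <= k)%N by rewrite -ltnS.
  have kD : (k <= D)%N by rewrite -ltnS.
  have [k' [l' [h ->]]] : exists k' l', (l' <= k' <= D.+1)%N /\
      coord_form E j * hom_monomial D k l = hom_monomial D.+1 k' l'.
    case: j => [[|[|[|//]]] hj].
    - exists k.+1, l.+1; split; first by lia.
      rewrite (_ : Ordinal hj = o0); last by apply: val_inj.
      by rewrite /hom_monomial !subSS exprS !mulrA.
    - exists k.+1, l; split; first by lia.
      rewrite (_ : Ordinal hj = o1); last by apply: val_inj.
      by rewrite /hom_monomial subSn // subSS exprS !mulrA [Y * _]mulrC.
    - exists k, l; split; first by lia.
      rewrite (_ : Ordinal hj = o2); last by apply: val_inj.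
      by rewrite /hom_monomial (subSn kD) exprS mulrCA.
  by exists (c%:P%:P * (('X^l')%:P * 'X^k')); rewrite homogenizeZ homogenize_monomial.
apply: eq_bigr => k _; apply: eq_bigr => i _; rewrite coef_blowup_homogenize //.
by have := ltn_ord k; have := ltn_ord i; lia.
Qed.

(* Membership in the N-th power of the ideal (X, Y) of the point E o2. *)
Lemma order_ge_decomp N D f : f \is D.-homog -> eq_upto N (bl f) 0 ->
  exists2 m : 'I_N.+1 -> {mpoly K[3]}, (forall l, m l \is (D - N).-homog)
    & f = \sum_l m l * hom_monomial N N l.
Proof.
move=> hf h0; rewrite -(blowupK hf) /homogenize.
pose P g := exists2 m : 'I_N.+1 -> {mpoly K[3]}, (forall l, m l \is (D - N).-homog)
    & g = \sum_l m l * hom_monomial N N l.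
have P0 : P 0 by exists (fun=> 0) => [l|]; rewrite ?rpred0 // big1 // => l _; rewrite mul0r.
have PD g g' : P g -> P g' -> P (g + g').
  move=> [m hm ->] [m' hm' ->]; exists (fun l => m l + m' l) => [l|].
    by rewrite rpredD.
  by rewrite -big_split; apply: eq_bigr => l _; rewrite mulrDl.
apply: (big_ind P) => // k _; apply: (big_ind P) => // i _.
have [kN|Nk] := ltnP k N; first by rewrite (h0 k kN) !coef0 scale0r.
have ik := ltn_ord i; have kD := ltn_ord k.
(* From [X^i Y^(k-i)] with [k >= N], split off the factor [X^(min(i,N)) Y^(N-min(i,N))] of degree
   exactly [N]. *)
have ltl : (minn i N < N.+1)%N by lia.
exists (fun l => if l == Ordinal ltl then (bl f)`_k`_i *:
  (X ^+ (i - minn i N) * Y ^+ (k - i - (N - minn i N)) * Z ^+ (D - k)) else 0).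
  move=> l; case: eqP => _; last exact: rpred0.
  rewrite rpredZ //.
  rewrite (_ : D - N = (i - minn i N) + (k - i - (N - minn i N)) + (D - k))%N; last by lia.
  by do !apply: dhomogM; apply: dhomog_coord_formX.
rewrite (bigD1 (Ordinal ltl)) //= eqxx big1 ?addr0 => [|l /negbTE ->]; last by rewrite mul0r.
rewrite -scalerAl; congr (_ *: _); rewrite /hom_monomial /= subnn expr0 mulr1.
rewrite -{1}(@subnK (minn i N) i) ?geq_minl //.
rewrite -{1}(@subnK (N - minn i N) (k - i)); last by lia.
by rewrite !exprD; ring.
Qed.

(** The coefficients [m l] are not determined by [f], but their values at the point are: the
    generator of index [l] blows up to [t^l tau^N]. *)
Lemma meval_hom_coef N f (m : 'I_N.+1 -> {mpoly K[3]}) :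
  f = \sum_l m l * hom_monomial N N l ->
  forall l, (m l).@[E o2] = (bl f)`_N`_l.
Proof.
move=> -> l; rewrite blowup_sum !coef_sum (bigD1 l) //= big1 => [|j /negbTE hj].
  rewrite addr0 blowupM blowup_hom_monomial -1?ltnS // mulrA coefMXn ltnn subnn.
  by rewrite coefMC coef0_blowup coefCM coefXn eqxx mulr1.
rewrite blowupM blowup_hom_monomial -1?ltnS // mulrA coefMXn ltnn subnn.
by rewrite coefMC coef0_blowup coefCM coefXn eq_sym (inj_eq val_inj) hj mulr0.
Qed.

(* Nakayama: the Cramer determinant of the coefficients of the w l on the
   generators of the ideal (X, Y)^N is a unit at the point. *)
Lemma nakayama (J : {mpoly K[3]} -> Prop) N D (w : 'I_N.+1 -> {mpoly K[3]}) :
  J 0 -> (forall f g, J f -> J g -> J (f + g)) -> (forall f g, J g -> J (f * g)) ->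
  (forall l, w l \is D.-homog) -> (forall l, J (w l)) ->
  (forall l, eq_upto N.+1 (bl (w l)) (('X^l)%:P * 'X^N)) ->
  exists k, exists2 d, d \is k.-homog &
    d.@[E o2] != 0 /\ forall l : 'I_N.+1, J (d * hom_monomial N N l).
Proof.
move=> J0 JD JM hw Jw ew.
have [m hm wE] : exists2 m : 'I_N.+1 -> 'I_N.+1 -> {mpoly K[3]},
    forall l j, m l j \is (D - N).-homog &
    forall l, w l = \sum_j m l j * hom_monomial N N j.
  have h l : exists m : 'I_N.+1 -> {mpoly K[3]}, (forall j, m j \is (D - N).-homog) /\
      w l = \sum_j m j * hom_monomial N N j.
    have [|m hm we] := @order_ge_decomp N D _ (hw l); last by exists m.
    by move=> k hk; rewrite ew ?coef0 ?coefMXn ?hk //; lia.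
  have [m hm] := choice h; exists m => [l j|l]; first exact: (hm l).1.
  exact: (hm l).2.
pose M := \matrix_(l, j) m l j.
exists (\sum_(i < N.+1) (D - N))%N, (\det M).
  apply: rpred_sum => s _; rewrite -signr_odd; case: (odd _); rewrite ?mul1r ?mulN1r ?rpredN.
    by apply: dhomog_prodr => i _; rewrite mxE.
  by apply: dhomog_prodr => i _; rewrite mxE.
split.
  (* At the point the matrix becomes the identity, since the [w l] have the generators as leading
     terms. *)
  rewrite -(det_map_mx (meval (E o2))) (_ : map_mx _ _ = 1%:M) ?det1 ?oner_neq0 //.
  apply/matrixP => l j; rewrite !mxE /= (meval_hom_coef (wE l)) ew //.
  by rewrite coefMXn ltnn subnn coefC coefXn eq_sym (inj_eq val_inj).
move=> l.
have -> : \det M * hom_monomial N N l = \sum_j (\adj M) l j * w j.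
  have /(congr1 (fun A => A *m \col_j hom_monomial N N j)) := mul_adj_mx M.
  rewrite -mulmxA mul_scalar_mx => /matrixP/(_ l 0); rewrite !mxE => <-.
  apply: eq_bigr => j _; congr (_ * _); rewrite wE mxE.
  by apply: eq_bigr => i _; rewrite !mxE.
by apply: (big_ind J) => // j _; apply: JM.
Qed.

End Homogenization.

(** * The Tjurina number of an ordinary point *)

Section Sylvester.
Variables (K : fieldType) (s : nat) (p q : {poly K}).
Hypothesis (sp : (size p <= s.+1)%N) (sq : (size q <= s.+1)%N).
Hypothesis no_syzygy : forall u w : {poly K}, (size u <= s)%N -> (size w <= s)%N ->
  u * p + w * q = 0 -> u = 0 /\ w = 0.

(** The map sending [(u, w)] to [u p + w q] goes between spaces of the same dimension [2 s]; it is
    injective by hypothesis, hence onto. *)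
Lemma bezout_of_no_syzygy (r : {poly K}) : (size r <= s + s)%N ->
  exists u w : {poly K}, [/\ (size u <= s)%N, (size w <= s)%N & r = u * p + w * q].
Proof.
move=> sr; pose comb (v : 'rV[K]_(s + s)) := rVpoly (lsubmx v) * p + rVpoly (rsubmx v) * q.
pose L (v : 'rV[K]_(s + s)) : 'rV[K]_(s + s) := poly_rV (comb v).
have combL : linear comb.
  by move=> a x y; rewrite /comb !linearP /= !mulrDl -!scalerAl scalerDr addrACA.
have L_lin : linear L by move=> a x y; rewrite /L combL linearP.
pose LL : {linear 'rV[K]_(s + s) -> 'rV[K]_(s + s)} :=
  HB.pack L (GRing.isLinear.Build K _ _ _ L L_lin).
have size_comb v : (size (comb v) <= s + s)%N.
  have hu := size_poly s (fun k => if insub k is Some i then (lsubmx v) 0 i else 0).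
  have hw := size_poly s (fun k => if insub k is Some i then (rsubmx v) 0 i else 0).
  rewrite -!/(rVpoly _) in hu hw.
  rewrite (leq_trans (size_polyD _ _)) // geq_max.
  by apply/andP; split; apply: leq_trans (size_polyMleq _ _) _; lia.
have M_free : row_free (lin1_mx LL).
  apply/row_freeP; exists (invmx (lin1_mx LL)); apply: mulmxV.
  rewrite -row_free_unit -kermx_eq0; apply/eqP/row_matrixP => i; rewrite row0.
  set v := row i _; have : v *m lin1_mx LL = 0.
    by apply/sub_kermxP; rewrite row_sub.
  rewrite mul_rV_lin1 /= => /(congr1 rVpoly).
  rewrite poly_rV_K // linear0 => /no_syzygy[]; rewrite ?size_poly // => h1 h2.
  rewrite -[v]hsubmxK -[lsubmx v]rVpolyK -[rsubmx v]rVpolyK h1 h2 !linear0.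
  by rewrite row_mx0.
have M_unit : lin1_mx LL \in unitmx by rewrite -row_free_unit.
pose v := poly_rV r *m invmx (lin1_mx LL).
have hv : L v = poly_rV r.
  by rewrite -[L v](mul_rV_lin1 LL) mulmxKV.
exists (rVpoly (lsubmx v)), (rVpoly (rsubmx v)); rewrite !size_poly; split=> //.
by have := congr1 rVpoly hv; rewrite !poly_rV_K.
Qed.

End Sylvester.

(** * Jets in two local coordinates *)

Section TruncatedForms.
Variables (K : numFieldType) (n : nat).

(** A pair [(k, i)] stands for [t^i tau^k], that is for [x^i y^(k-i)]: these are the monomials of
    degree less than [n], so [jets] models the local ring modulo the [n]-th power of its maximal
    ideal. *)
Definition jet_index := {x : 'I_n * 'I_n | (x.2 <= x.1)%N}.
Definition jets := {ffun jet_index -> K^o}.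

Lemma card_jet_index : (#|{: jet_index}| * 2 = n * n.+1)%N.
Proof.
rewrite card_sig -sum1_card.
rewrite -(pair_big_dep xpredT (fun k i : 'I_n => (i <= k)%N) (fun _ _ => 1%N)) /=.
rewrite (eq_bigr (fun k : 'I_n => k.+1)) => [|k _].
  elim: n => [|m IH]; first by rewrite big_ord0.
  by rewrite big_ord_recr /= mulnDl IH; lia.
rewrite -(big_ord_widen_cond _ xpredT (fun _ => 1%N) (ltn_ord k)).
by rewrite sum_nat_const card_ord muln1.
Qed.

Lemma dim_jets : \dim {: jets} = #|{: jet_index}|.
Proof. by rewrite dimvf /dim /= muln1. Qed.

Lemma dim_jets2 : \dim {: (jets * jets)%type} = (#|{: jet_index}| * 2)%N.
Proof. by rewrite dimvf /dim /= /dim /= !muln1 addnn -muln2. Qed.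

Definition jet_of (p : {poly {poly K}}) : jets :=
  [ffun x : jet_index => (p`_(val x).1`_(val x).2 : K^o)].

Definition poly_of_jet (u : jets) : {poly {poly K}} :=
  \sum_x ((u x)%:P * 'X^((val x).2))%:P * 'X^((val x).1).

Lemma graded_poly_of_jet u : graded (poly_of_jet u).
Proof.
apply: graded_sum => x _; apply: graded_monomial.
rewrite mul_polyC (leq_trans (size_scale_leq _ _)) // size_polyXn ltnS.
exact: valP x.
Qed.

Lemma coef_poly_of_jet u (x : jet_index) : (poly_of_jet u)`_(val x).1`_(val x).2 = u x.
Proof.
rewrite !coef_sum (bigD1 x) //= big1 => [|y hy].
  by rewrite addr0 coefCM coefXn eqxx mulr1 coefCM coefXn eqxx mulr1.
rewrite coefCM coefXn; case: eqP => [e1|]; last by rewrite mulr0 coef0.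
rewrite mulr1 coefCM coefXn; case: eqP => [e2|]; last by rewrite mulr0.
case/eqP: hy; apply/val_inj/eqP; rewrite -pair_eqE /=.
by rewrite -!(inj_eq val_inj) /= e1 e2 !eqxx.
Qed.

Lemma jet_of_polyK : cancel poly_of_jet jet_of.
Proof. by move=> u; apply/ffunP => x; rewrite ffunE coef_poly_of_jet. Qed.

Lemma jet_ofP p q : graded p -> graded q ->
  jet_of p = jet_of q <-> eq_upto n p q.
Proof.
move=> gp gq; split=> [h k kn|h].
  apply/polyP => i; have [ik|ki] := leqP i k.
    have kin : (i < n)%N by apply: leq_ltn_trans kn.
    have := congr1 (fun u : jets => u (exist _ (Ordinal kn, Ordinal kin) ik)) h.
    by rewrite !ffunE.
  rewrite [LHS]nth_default ?[RHS]nth_default //; first exact: leq_trans (gq k) ki.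
  exact: leq_trans (gp k) ki.
by apply/ffunP => x; rewrite !ffunE h.
Qed.

Lemma poly_of_jetK p : graded p -> eq_upto n (poly_of_jet (jet_of p)) p.
Proof.
by move=> gp; apply/jet_ofP => //; [exact: graded_poly_of_jet|rewrite jet_of_polyK].
Qed.

Lemma jet_of_poly_linear c p q :
  jet_of (c%:P%:P * p + q) = c *: jet_of p + jet_of q.
Proof. by apply/ffunP => x; rewrite !ffunE coefD coefCM coefD coefCM. Qed.

Lemma poly_of_jet_linear c u w :
  poly_of_jet (c *: u + w) = c%:P%:P * poly_of_jet u + poly_of_jet w.
Proof.
rewrite /poly_of_jet mulr_sumr -big_split; apply: eq_bigr => x _ /=.
rewrite mulrA -mulrDl -polyCM -polyCD mulrA -mulrDl -polyCM -polyCD.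
by rewrite !ffunE.
Qed.

End TruncatedForms.

Lemma sub_scaled_fractions (F : fieldType) (a b a' b' c : F) : b != 0 -> b' != 0 ->
  a / b - c * (a' / b') = (a * b' - c * (a' * b)) / (b * b').
Proof. by move=> b0 b'0; field; rewrite b0 b'0. Qed.

Lemma fraction_expand (F : fieldType) (a b c d : F) : c != 0 -> d != 0 ->
  a / b = d * (a * c) / (d * (b * c)).
Proof.
by move=> c0 d0; rewrite -mulf_div divff // mul1r -mulf_div divff // mulr1.
Qed.

Section JacobianIdeal.
Variables (K : numClosedFieldType) (F : {mpoly K[3]}).

Lemma jacobian_ideal_dirder (E : 'M[K]_3) (j : 'I_3) : jacobian_ideal F (dirder E j F).
Proof.
exists (fun i => (E j i)%:MP); rewrite dirder.unlock; apply: eq_bigr => i _.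
by rewrite mul_mpolyC.
Qed.

Lemma jacobian_idealD f g :
  jacobian_ideal F f -> jacobian_ideal F g -> jacobian_ideal F (f + g).
Proof.
move=> [a ->] [b ->]; exists (fun i => a i + b i).
by rewrite -big_split; apply: eq_bigr => i _; rewrite mulrDl.
Qed.

Lemma jacobian_idealM f g : jacobian_ideal F g -> jacobian_ideal F (f * g).
Proof.
move=> [a ->]; exists (fun i => f * a i).
by rewrite mulr_sumr; apply: eq_bigr => i _; rewrite mulrA.
Qed.

Lemma jacobian_ideal0 : jacobian_ideal F 0.
Proof. by exists (fun=> 0); rewrite big1 // => i _; rewrite mul0r. Qed.

End JacobianIdeal.

(** * The Jacobian ideal at a point, read on jets *)

Section LocalTjurina.
Variables (K : numClosedFieldType) (E : 'M[K]_3) (p : proj_plane K).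
Hypothesis E_unit : E \in unitmx.
Hypothesis E2 : E o2 =1 hcoord p.

Variables (F : {mpoly K[3]}) (e s : nat).
Hypothesis F_homog : F \is e.-homog.
Hypothesis s_gt0 : (0 < s)%N.
Hypothesis s_le3 : (s <= 3)%N.

Local Notation bl := (blowup E).
(** [G] is the tangent cone at [y = 1], and [N] is the order at which jets are truncated. *)
Local Notation G := ((bl F)`_s.+1).
Local Notation N := (2 * s).-1.

Hypothesis F_order : eq_upto s.+1 (bl F) 0.
Hypothesis no_syzygy : forall u w : {poly K}, (size u <= s)%N -> (size w <= s)%N ->
  u * G^`() + w * (G *+ s.+1 - 'X * G^`()) = 0 -> u = 0 /\ w = 0.

Local Notation A := (bl (dirder E o0 F)).
Local Notation B := (bl (dirder E o1 F)).

Lemma vanishesE f : vanishes f p = (f.@[E o2] == 0).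
Proof. by rewrite /vanishes (meval_eq _ E2). Qed.

Lemma order_dirder : eq_upto s A 0 /\ eq_upto s B 0.
Proof.
split=> k hk; rewrite ?coef_blowup_dirder0 ?coef_blowup_dirder1 F_order ?coef0 //.
  by rewrite deriv0.
by rewrite deriv0 mulr0 mul0rn subr0.
Qed.

Lemma lead_dirder : A`_s = G^`() /\ B`_s = G *+ s.+1 - 'X * G^`().
Proof. split; [exact: coef_blowup_dirder0|exact: coef_blowup_dirder1]. Qed.

(** A factor of order [s] gains [s] orders of precision. This is why multipliers of [A] and [B]
    matter only modulo [tau^(s-1)]. *)
Lemma eq_upto_mul_order (m : nat) (q q' r : {poly {poly K}}) :
  eq_upto m q q' -> eq_upto s r 0 -> eq_upto (m + s) (q * r) (q' * r).
Proof.
move=> hq hr k hk; rewrite !coefM; apply: eq_bigr => i _.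
have [im|mi] := ltnP i m; first by rewrite hq.
by rewrite hr ?coef0 ?mulr0 //; have := ltn_ord i; lia.
Qed.

Lemma coef_mul_order (q r : {poly {poly K}}) k :
  eq_upto k q 0 -> eq_upto s r 0 -> (q * r)`_(k + s) = q`_k * r`_s.
Proof.
move=> hq hr; have ks : (k < (k + s).+1)%N by lia.
rewrite coefM (bigD1 (Ordinal ks)) //= addKn big1 ?addr0 // => i hi.
have [ik|ki] := ltnP i k; first by rewrite hq // coef0 mul0r.
rewrite hr ?coef0 ?mulr0 //; have := ltn_ord i.
move: hi; rewrite -(inj_eq val_inj) /=; lia.
Qed.

Lemma dirder2_combination : exists c : K,
  eq_upto N (bl (dirder E o2 F)) (c%:P%:P * ('X * 'X%:P * A + 'X * B)).
Proof.
(* Euler's formula gives the third derivative as [e F - (x A + y B)]. Below [tau^N] only the initial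
   form of [F] is visible, and there [x A + y B = (s + 1) F]. *)
exists (e%:R / s.+1%:R - 1) => k hk.
have hC := congr1 (fun q : {poly {poly K}} => q`_k) (euler_blowup E_unit F_homog).
rewrite coefD coefMn in hC; rewrite coefCM.
have [oA oB] := order_dirder; have [lA lB] := lead_dirder.
move: (A) (B) oA oB lA lB hC => a b oA oB lA lB hC.
have hAB : ('X * 'X%:P * a + 'X * b)`_k = (bl F)`_k *+ s.+1.
  rewrite coefD -mulrA !coefXM coefCM; case: k hk {hC} => [|k] hk /=.
    by rewrite addr0 F_order // coef0 mul0rn.
  have [ks|sk] := ltnP k s; first by rewrite oA ?oB ?F_order // !coef0 mulr0 mul0rn addr0.
  (* From [k + 1 < 2 s - 1] and [s <= 3] follows [k <= s]. *)
  have -> : k = s by lia.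
  by rewrite lA lB addrC subrK.
have -> : (bl (dirder E o2 F))`_k = (bl F)`_k *+ e - (bl F)`_k *+ s.+1.
  by rewrite -hC hAB addrC addKr.
rewrite hAB -[(bl F)`_k *+ e]mulr_natl -[(bl F)`_k *+ s.+1]mulr_natl mulrA -mulrBl.
congr (_ * _); rewrite -!polyC_natr -polyCM -polyCB mulrBl mul1r divfK //.
by rewrite pnatr_eq0.
Qed.

Lemma blowup_jacobian_ideal f : jacobian_ideal F f ->
  exists a b : {poly {poly K}}, [/\ graded a, graded b & eq_upto N (bl f) (a * A + b * B)].
Proof.
move=> [g ->]; have [c hc] := dirder2_combination.
pose h j := \sum_i bl (g i) * (invmx E i j)%:P%:P.
have gh j : graded (h j).
  by apply: graded_sum => i _; rewrite mulrC; apply/gradedMC/graded_blowup.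
have hE : bl (\sum_i g i * mderiv i F) = \sum_j h j * bl (dirder E j F).
  rewrite blowup_sum; under [RHS]eq_bigr do rewrite mulr_suml.
  rewrite exchange_big; apply: eq_bigr => i _ /=.
  rewrite blowupM (mderiv_dirder E_unit) blowup_sum mulr_sumr.
  by apply: eq_bigr => j _; rewrite blowupZ mulrA.
have gX : graded ('X : {poly {poly K}}).
  by rewrite -['X]mul1r -['X]expr1; apply: graded_monomial; rewrite size_poly1.
have gXX : graded ('X * 'X%:P : {poly {poly K}}).
  by rewrite mulrC -['X in X in _ * X]expr1; apply: graded_monomial; rewrite size_polyX.
(* The multiplier of the third direction is distributed over the other two. *)
exists (h o0 + h o2 * c%:P%:P * ('X * 'X%:P)), (h o1 + h o2 * c%:P%:P * 'X).
split.
- by apply: gradedD => //; apply: gradedM => //; rewrite mulrC; apply: gradedMC.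
- by apply: gradedD => //; apply: gradedM => //; rewrite mulrC; apply: gradedMC.
rewrite hE big_ord3.
rewrite [X in eq_upto _ _ X](_ : _ = h o0 * A + h o1 * B
  + h o2 * (c%:P%:P * ('X * 'X%:P * A + 'X * B))); last by ring.
by apply: eq_uptoD => //; apply: eq_uptoM.
Qed.

(** The graph of the truncated expansion at [p] of a fraction [a / b], cleared of its
    denominator. *)
Definition local_jet (q : {fraction {mpoly K[3]}}) (u : jets K N) : Prop :=
  exists k : nat, exists a b : {mpoly K[3]},
    [/\ a \is k.-homog, b \is k.-homog, ~~ vanishes b p,
        q = FracField.tofrac a / FracField.tofrac b
      & eq_upto N (bl a) (poly_of_jet u * bl b)].

Lemma vanishesM f g : vanishes (f * g) p = vanishes f p || vanishes g p.
Proof. by rewrite /vanishes mevalM mulf_eq0. Qed.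

Lemma nvanishes_neq0 f : ~~ vanishes f p -> f != 0.
Proof. by apply: contraNneq => ->; rewrite /vanishes meval0. Qed.

Lemma coef0_nvanishes f : ~~ vanishes f p ->
  f.@[E o2] != 0 /\ (bl f)`_0 = (f.@[E o2])%:P.
Proof. by rewrite vanishesE coef0_blowup. Qed.

Lemma local_jet_stalk q u : local_jet q u -> stalk setT p q.
Proof. by move=> [k [a [b [ha hb vb qE _]]]]; exists k, a, b. Qed.

Lemma local_jet_total q : stalk setT p q -> exists u, local_jet q u.
Proof.
move=> [k [a [b [ha hb _ vb qE]]]]; have [b0 hb0] := coef0_nvanishes vb.
have [r gr hr] := inverse_upto N b0 hb0 (graded_blowup E b).
exists (jet_of N (bl a * r)), k, a, b; split=> //.
apply/eq_upto_sym/(@eq_upto_trans _ _ (bl a * r * bl b)).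
  by apply: eq_uptoM => //; apply: poly_of_jetK; apply/gradedM/gr/graded_blowup.
rewrite -mulrA -[X in eq_upto _ _ X]mulr1.
by apply: eq_uptoM.
Qed.

Lemma local_jet_surj u : exists q, local_jet q u.
Proof.
pose Z := coord_form E o2; pose a := homogenize E N (poly_of_jet u).
exists (FracField.tofrac a / FracField.tofrac (Z ^+ N)), N, a, (Z ^+ N); split=> //.
- exact: homogenize_homog.
- exact: dhomog_coord_formX.
- rewrite vanishesE; have := coef0_blowup E (Z ^+ N).
  rewrite blowupXn blowup_coord_form2 // expr1n coef1 => /esym h.
  by rewrite -polyC_eq0 h oner_neq0.
move=> k hk; rewrite blowupXn blowup_coord_form2 // expr1n mulr1.
by rewrite blowup_homogenize //; [apply: graded_poly_of_jet|exact: ltnW].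
Qed.

Lemma local_jet_lin c q q' u u' : local_jet q u -> local_jet q' u' ->
  local_jet (q - scale_frac c q') (u - c *: u').
Proof.
move=> [k [a [b [ha hb vb -> hu]]]] [k' [a' [b' [ha' hb' vb' -> hu']]]].
exists (k + k')%N, (a * b' - c *: (a' * b)), (b * b'); split.
- by apply: rpredB; [|apply: rpredZ; rewrite mulrC]; apply: dhomogM.
- exact: dhomogM.
- by rewrite vanishesM negb_or vb vb'.
- rewrite /scale_frac -mul_mpolyC tofracB !tofracM.
  have b0 : FracField.tofrac b != 0 by rewrite tofrac_eq0 nvanishes_neq0.
  have b'0 : FracField.tofrac b' != 0 by rewrite tofrac_eq0 nvanishes_neq0.
  by rewrite (sub_scaled_fractions _ _ _ b0 b'0).
rewrite blowupB blowupZ !blowupM.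
rewrite (_ : poly_of_jet _ * _ = poly_of_jet u * bl b * bl b'
   - c%:P%:P * (poly_of_jet u' * bl b' * bl b)).
  by apply: eq_uptoB; do ?apply: eq_uptoM.
rewrite addrC -scaleNr poly_of_jet_linear !polyCN; ring.
Qed.

(* The tangent cone has no syzygies, so modulo tau^N every element of the ideal
   (A, B) has a unique expression with coefficients of degree < s - 1. *)
Definition jacobian_jet (x : jets K s.-1 * jets K s.-1) : jets K N :=
  jet_of N (poly_of_jet x.1 * A + poly_of_jet x.2 * B).

Lemma jacobian_jet_linear : linear jacobian_jet.
Proof.
move=> c x y; rewrite /jacobian_jet -jet_of_poly_linear /= !poly_of_jet_linear.
by congr jet_of; rewrite mulrDr !mulrDl !mulrA addrACA.
Qed.

HB.instance Definition _ := GRing.isLinear.Build K _ _ _ jacobian_jet jacobian_jet_linear.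

Definition jacobian_jets : {vspace jets K N} := limg (linfun jacobian_jet).

(** The coefficients vanish one order at a time: when those below [k] are zero, the coefficient of
    [tau^(k+s)] is a syzygy of the initial forms with multipliers of size at most [k.+1]. *)
Lemma jacobian_jet_inj x : jacobian_jet x = 0 -> x = 0.
Proof.
case: x => u w h; have [oA oB] := order_dirder; have [lA lB] := lead_dirder.
have gu := graded_poly_of_jet u; have gw := graded_poly_of_jet w.
have h0 : eq_upto N (poly_of_jet u * A + poly_of_jet w * B) 0.
  apply/jet_ofP; first by do !(apply: gradedD || apply: gradedM || exact: graded_blowup).
    exact: graded0.
  by rewrite -/(jacobian_jet (u, w)) h; apply/ffunP => y; rewrite !ffunE !coef0.
have hz k : (k <= s.-1)%N -> eq_upto k (poly_of_jet u) 0 /\ eq_upto k (poly_of_jet w) 0.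
  elim: k => [|k IH] hk; first by split.
  have [hu hw] := IH (ltnW hk).
  have : ((poly_of_jet u * A + poly_of_jet w * B)`_(k + s)) = 0.
    by rewrite h0 ?coef0 //; lia.
  rewrite coefD (coef_mul_order hu oA) (coef_mul_order hw oB) lA lB => /no_syzygy[].
  - by apply: leq_trans (gu k) _; lia.
  - by apply: leq_trans (gw k) _; lia.
  move=> uk wk; split=> j; rewrite ltnS leq_eqVlt => /orP[/eqP ->|hj].
  - by rewrite uk coef0.
  - exact: hu.
  - by rewrite wk coef0.
  - exact: hw.
have [hu hw] := hz _ (leqnn _); congr pair; rewrite -[LHS]jet_of_polyK.
  by apply/ffunP => y; rewrite !ffunE hu ?coef0.
by apply/ffunP => y; rewrite !ffunE hw ?coef0.
Qed.

Lemma dim_jacobian_jets : (\dim {: jets K N} - \dim jacobian_jets = s ^ 2)%N.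
Proof.
rewrite limg_dim_eq.
  rewrite dim_jets2 dim_jets; have := card_jet_index N; rewrite (card_jet_index s.-1) -mulnn.
  by case: (s) s_gt0 => [//|t] _ /=; move: #|_| => c; nia.
apply/eqP; rewrite -subv0; apply/subvP => x; rewrite memv_cap memv_ker.
by case/andP => _; rewrite lfunE => /eqP/jacobian_jet_inj ->; rewrite memv0.
Qed.

(** An element of the stalk is expanded by clearing one denominator and inverting the other modulo
    [tau^N]. Conversely, a jet in [jacobian_jets] only yields an element of the ideal that agrees
    with the fraction modulo [tau^N]; the difference is absorbed by the multiplier from
    [nakayama]. *)
Lemma stalk_jacobian_jets q u : local_jet q u ->
  stalk (jacobian_ideal F) p q <-> u \in jacobian_jets.
Proof.
move=> [k [a [b [ha hb vb qE hu]]]]; have [b0 hb0] := coef0_nvanishes vb.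
have [oA oB] := order_dirder; have [lA lB] := lead_dirder.
split=> [[k' [a' [b' [ha' hb' Ja' vb' qE']]]]|].
  have [b'0 hb'0] := coef0_nvanishes vb'.
  have ab : a * b' = a' * b.
    apply/eqP; rewrite -tofrac_eq !tofracM -(eqr_div _ _ _ _) -?qE ?qE' //.
      by rewrite tofrac_eq0 nvanishes_neq0.
    by rewrite tofrac_eq0 nvanishes_neq0.
  have [al [be [gal gbe hab]]] := blowup_jacobian_ideal Ja'.
  have [r gr hr] := inverse_upto N b'0 hb'0 (graded_blowup E b').
  have h1 : eq_upto N (poly_of_jet u * bl b') (al * A + be * B).
    apply: (@eq_upto_cancel _ _ (bl b) _ _ _ b0 hb0).
    apply: (@eq_upto_trans _ _ (bl a' * bl b)); last by apply: eq_uptoM.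
    rewrite -blowupM -ab blowupM mulrAC; apply: eq_uptoM => //; exact: eq_upto_sym.
  have h2 : eq_upto N (poly_of_jet u) (r * al * A + r * be * B).
    rewrite -!mulrA -mulrDr.
    apply: (@eq_upto_trans _ _ (r * (poly_of_jet u * bl b'))).
      rewrite mulrCA -[X in eq_upto _ X]mulr1; apply: eq_uptoM => //; exact: eq_upto_sym.
    exact: eq_uptoM.
  have gra : graded (r * al) by apply: gradedM.
  have grb : graded (r * be) by apply: gradedM.
  (* Truncating the multipliers at [tau^(s-1)] changes nothing below [tau^N], as [A] and [B] have
     order [s]. *)
  apply/memv_imgP; exists (jet_of s.-1 (r * al), jet_of s.-1 (r * be)); first exact: memvf.
  rewrite lfunE /= -[LHS]jet_of_polyK; apply/jet_ofP.
  - exact: graded_poly_of_jet.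
  - by do !(apply: gradedD || apply: gradedM || exact: graded_blowup
    || exact: graded_poly_of_jet).
  apply: (eq_upto_trans h2).
  have Ns : N = (s.-1 + s)%N by clear -s_gt0; lia.
  by rewrite Ns; apply: eq_uptoD; apply: eq_upto_mul_order => //; apply/eq_upto_sym/poly_of_jetK.
case/memv_imgP => x _; rewrite lfunE /= => ux.
have h1 : eq_upto N (poly_of_jet u) (poly_of_jet x.1 * A + poly_of_jet x.2 * B).
  apply/jet_ofP; last by rewrite ux jet_of_polyK.
    exact: graded_poly_of_jet.
  by do !(apply: gradedD || apply: gradedM || exact: graded_blowup
    || exact: graded_poly_of_jet).
pose hg (y : jets K s.-1) := homogenize E N (poly_of_jet y).
(* A form in the ideal such that [w / Z^D] has the jet [u]; hence the numerator [f] of the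
   difference with [a / b] has order at least [N]. *)
pose w := hg x.1 * dirder E o0 F + hg x.2 * dirder E o1 F.
pose Z := coord_form E o2; pose D := (N + e.-1)%N.
have hdir j : dirder E j F \is e.-1.-homog by apply: dirder_homog.
have hw : w \is D.-homog by rewrite rpredD ?dhomogM ?homogenize_homog.
have hhg y : eq_upto N (bl (hg y)) (poly_of_jet y).
  move=> j hj; rewrite blowup_homogenize //; [exact: graded_poly_of_jet|exact: ltnW].
have Jw : jacobian_ideal F w.
  by apply: jacobian_idealD; apply/jacobian_idealM/jacobian_ideal_dirder.
have hZ : bl (Z ^+ D) = 1 by rewrite blowupXn blowup_coord_form2 // expr1n.
pose f := a * Z ^+ D - w * b.
have hf : f \is (k + D).-homog.
  by apply: rpredB; [|rewrite addnC]; apply: dhomogM => //; apply: dhomog_coord_formX.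
have f0 : eq_upto N (bl f) 0.
  rewrite blowupB !blowupM hZ mulr1 -(subrr (poly_of_jet u * bl b)).
  apply: eq_uptoB => //; apply: eq_uptoM => //.
  apply/eq_upto_sym/(eq_upto_trans h1).
  by rewrite blowupD !blowupM; apply: eq_uptoD; apply: eq_uptoM => //; apply: eq_upto_sym.
have [m hm fE] := order_ge_decomp E_unit hf f0.
(* Each [t^l] with [l <= N] has size at most [2 s], the exact range of the Sylvester argument. *)
have h2 (l : 'I_N.+1) : exists uw : {poly K} * {poly K},
    [/\ (size uw.1 <= s)%N, (size uw.2 <= s)%N &
     'X^l = uw.1 * G^`() + uw.2 * (G *+ s.+1 - 'X * G^`())].
  have sA : (size G^`() <= s.+1)%N by rewrite -lA graded_blowup.
  have sB : (size (G *+ s.+1 - 'X * G^`())%R <= s.+1)%N by rewrite -lB graded_blowup.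
  have [|u' [w' [h3 h4 h5]]] := bezout_of_no_syzygy sA sB no_syzygy (r := 'X^l).
    by rewrite size_polyXn; have := ltn_ord l; clear -s_gt0; lia.
  by exists (u', w').
have [uw huw] := choice h2.
pose hs (y : {poly K}) := homogenize E s.-1 (y%:P * 'X^(s.-1)).
have hhs (y : {poly K}) : (size y <= s)%N -> eq_upto s (bl (hs y)) (y%:P * 'X^(s.-1)).
  move=> sy j hj; rewrite blowup_homogenize -1?ltnS ?prednK //.
  by apply: graded_monomial; rewrite prednK.
(* Lifting the multipliers to forms of degree [s - 1] gives elements of the ideal with leading term
   [t^l tau^N], as [nakayama] requires. *)
pose wl (l : 'I_N.+1) := hs (uw l).1 * dirder E o0 F + hs (uw l).2 * dirder E o1 F.
have wl_homog l : wl l \is (s.-1 + e.-1).-homog.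
  by apply: rpredD; apply: dhomogM => //; apply: homogenize_homog.
have wl_jacobian l : jacobian_ideal F (wl l).
  by apply: jacobian_idealD; apply/jacobian_idealM/jacobian_ideal_dirder.
have wl_lead l : eq_upto N.+1 (bl (wl l)) (('X^l)%:P * 'X^N).
  have [s1 s2 lE] := huw l.
  have Ns : N.+1 = (s + s)%N by clear -s_gt0; lia.
  apply: (@eq_upto_trans _ _ ((uw l).1%:P * 'X^(s.-1) * A + (uw l).2%:P * 'X^(s.-1) * B)).
    by rewrite blowupD !blowupM Ns; apply: eq_uptoD; apply: eq_upto_mul_order => //; apply: hhs.
  have zX (y : {poly K}) : eq_upto s.-1 (y%:P * 'X^(s.-1)) 0.
    by move=> j hj; rewrite coefMXn hj coef0.
  move=> j; rewrite ltnS leq_eqVlt => /orP[/eqP ->|hj].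
    have Ns' : N = (s.-1 + s)%N by clear -s_gt0; lia.
    rewrite coefD {1 2}Ns' (coef_mul_order (zX _) oA) (coef_mul_order (zX _) oB).
    by rewrite !coefMXn !ltnn !subnn !coefC /= lA lB -lE.
  rewrite [RHS]coefMXn hj.
  have h3 (y : {poly K}) r : eq_upto s r 0 -> (y%:P * 'X^(s.-1) * r)`_j = 0.
    move=> hr; rewrite (eq_upto_mul_order (zX y) hr) ?mul0r ?coef0 //; lia.
  by rewrite coefD (h3 _ _ oA) (h3 _ _ oB) addr0.
have [kd [d hd [vd Jd]]] := nakayama E_unit (jacobian_ideal0 F)
  (@jacobian_idealD _ F) (@jacobian_idealM _ F) wl_homog wl_jacobian wl_lead.
have Jdf : jacobian_ideal F (d * f).
  rewrite fE mulr_sumr; apply: (big_ind (jacobian_ideal F)).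
  - exact: jacobian_ideal0.
  - exact: jacobian_idealD.
  by move=> l _; rewrite mulrCA; apply/jacobian_idealM/Jd.
have vZ : ~~ vanishes (Z ^+ D) p.
  rewrite vanishesE; have := coef0_blowup E (Z ^+ D); rewrite hZ coef1 => /esym h.
  by rewrite -polyC_eq0 h oner_neq0.
(* Expanding the fraction by [d Z^D] turns its numerator into [d f + d b w], a sum of two elements
   of the ideal. *)
exists (kd + (k + D))%N, (d * (a * Z ^+ D)), (d * (b * Z ^+ D)); split.
- by do 2!(apply: dhomogM => //); apply: dhomog_coord_formX.
- by do 2!(apply: dhomogM => //); apply: dhomog_coord_formX.
- have -> : d * (a * Z ^+ D) = d * f + d * b * w by rewrite /f; ring.
  by apply: jacobian_idealD => //; apply: jacobian_idealM.
- by rewrite !vanishesM !negb_or vb vZ vanishesE vd.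
rewrite qE !tofracM.
have d0 : FracField.tofrac d != 0 by rewrite tofrac_eq0 nvanishes_neq0 // vanishesE.
have Z0 : FracField.tofrac (Z ^+ D) != 0 by rewrite tofrac_eq0 nvanishes_neq0.
by rewrite -(fraction_expand _ _ Z0 d0).
Qed.

Lemma tjurina_of_tangent_cone : tjurina F p = (s ^ 2)%N.
Proof.
rewrite -dim_jacobian_jets; apply: (quotient_dimE (rho := local_jet)).
- exact: local_jet_stalk.
- exact: local_jet_total.
- exact: local_jet_surj.
- exact: local_jet_lin.
- exact: stalk_jacobian_jets.
Qed.

End LocalTjurina.

(** * Tangent cones with distinct roots *)

Section TangentCone.
Variable K : numFieldType.

Lemma prod_order (I : finType) (P : {set I}) (q : I -> {poly {poly K}}) :
  (forall i, i \in P -> (q i)`_0 = 0) ->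
  eq_upto #|P| (\prod_(i in P) q i) 0 /\
  (\prod_(i in P) q i)`_#|P| = \prod_(i in P) (q i)`_1.
Proof.
move=> hq; have h i : exists q', i \in P -> q i = q' * 'X.
  have [/hq|] := boolP (i \in P); last by exists 0.
  elim/poly_ind: (q i) => [|q' c _]; first by exists 0; rewrite mul0r.
  by rewrite coefD coefMX coefC add0r => -> /=; exists q'; rewrite polyC0 addr0.
have [q' hq'] := choice h.
have -> : \prod_(i in P) q i = (\prod_(i in P) q' i) * 'X^#|P|.
  by rewrite (eq_bigr _ hq') big_split /= prodr_const.
split=> [k hk|]; first by rewrite coefMXn hk coef0.
rewrite coefMXn ltnn subnn coef0_prod; apply: eq_bigr => i iP.
by rewrite hq' // coefMX.
Qed.

(* At each of the #|P| roots of G, u - t w vanishes because G' does not; so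
   u = t w, and then w G = 0. *)
Lemma no_syzygy_of_distinct_tangents (I : finType) (P : {set I}) (c : K) (al be : I -> K) :
  c != 0 -> (0 < #|P|)%N ->
  (forall i, i \in P -> al i != 0) ->
  (forall i j, i \in P -> j \in P -> i != j -> al i * be j != al j * be i) ->
  let G := (\prod_(i in P) ('X * (al i)%:P + (be i)%:P)) * c%:P in
  forall u w : {poly K}, (size u <= #|P|.-1)%N -> (size w <= #|P|.-1)%N ->
  u * G^`() + w * (G *+ #|P| - 'X * G^`()) = 0 -> u = 0 /\ w = 0.
Proof.
move=> c0 P0 hal hne G u w su sw huw.
(* The finite root of the [i]-th tangent; these roots are distinct because the tangents are pairwise
   not proportional. *)
pose z i := - (be i / al i).
have ev i x : ('X * (al i)%:P + (be i)%:P).[x] = x * al i + be i.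
  by rewrite !hornerE.
have evz i : i \in P -> ('X * (al i)%:P + (be i)%:P).[z i] = 0.
  by move=> iP; rewrite ev mulNr divfK ?hal // addNr.
have Gz i : i \in P -> G.[z i] = 0.
  by move=> iP; rewrite /G (bigD1 i) //= !hornerM evz // !mul0r.
have G'z i : i \in P -> G^`().[z i] != 0.
  move=> iP; rewrite /G derivM derivC mulr0 addr0 (bigD1 i) //= derivM.
  rewrite hornerM hornerD !hornerM evz // mul0r addr0 hornerC mulf_neq0 //.
  rewrite derivD derivM derivX !derivC mulr0 mul1r !addr0 hornerC.
  rewrite mulf_neq0 ?hal // horner_prod prodf_seq_neq0.
  apply/allP => j _; apply/implyP => /andP[jP ji]; rewrite ev.
  have := hne _ _ jP iP ji; apply: contraNneq => /(congr1 (fun x => x * al i)).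
  rewrite mul0r mulrDl mulNr mulNr mulrAC divfK ?hal //.
  move=> e; rewrite -subr_eq0; apply/eqP; rewrite -[RHS]oppr0 -e; ring.
have hz : u - 'X * w = 0.
  apply/eqP; apply: contraT => nz.
  have z_inj : {in P &, injective z}.
    move=> i j iP jP /oppr_inj /eqP; rewrite eqr_div ?hal // => e.
    by apply/eqP; apply: contraTT e => ij; rewrite mulrC [_ * al i]mulrC eq_sym hne // eq_sym.
  have hs : (size (u - 'X * w)%R <= #|P|)%N.
    rewrite (leq_trans (size_polyD _ _)) // size_polyN geq_max.
    rewrite (leq_trans su) ?leq_pred //= (leq_trans (size_polyMleq _ _)) // size_polyX.
    by clear -sw P0; lia.
  have := max_poly_roots nz (rs := [seq z i | i in P]).
  rewrite size_map -cardE ltnNge hs map_inj_in_uniq ?enum_uniq; last first.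
    by move=> i j; rewrite !mem_enum; apply: z_inj.
  move=> h; suff : all (root (u - 'X * w)) [seq z i | i in P] by move=> /h/(_ isT).
  apply/allP => _ /mapP[j + ->]; rewrite mem_enum => jP.

  rewrite rootE; have /(congr1 (fun q : {poly K} => q.[z j])) := huw.
  rewrite !hornerE hornerMn Gz // mul0rn sub0r => /eqP.
  by rewrite mulrN mulrA -mulrBl mulf_eq0 (negbTE (G'z j jP)) orbF [_ * z j]mulrC.
have uE : u = 'X * w by apply/eqP; rewrite -subr_eq0 hz.
have G0 : G != 0.
  rewrite mulf_neq0 ?polyC_eq0 // prodf_seq_neq0; apply/allP => i _; apply/implyP => iP.
  apply: contraNneq (hal i iP) => /(congr1 (fun q : {poly K} => q`_1)).
  by rewrite coefD coefXM !coefC /= ?coef0 addr0 => ->.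
clearbody G; have w0 : w = 0.
  move: huw; rewrite uE (_ : _ + _ = w * G * #|P|%:R); last by rewrite -mulr_natr; ring.
  move/eqP; rewrite !mulf_eq0 (negbTE G0) -polyC_natr polyC_eq0 pnatr_eq0.
  by rewrite (gtn_eqF P0) !orbF => /eqP.
by rewrite uE w0 mulr0.
Qed.

End TangentCone.

(** * Points and frames of the projective plane *)

Section Frames.
Variable K : numClosedFieldType.

Lemma hcoord_neq0 (p : proj_plane K) : exists i, hcoord p i != 0.
Proof.
have v0 : vpick (val p) != 0 by rewrite vpick0 -dimv_eq0 (eqP (valP p)).
apply/existsP; apply: contraNT v0 => /existsPn h; apply/eqP/rowP => i.
by rewrite [RHS]mxE; apply/eqP; have := h i; rewrite negbK.
Qed.

Lemma proj_planeP (p q : proj_plane K) c : c != 0 ->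
  (forall i, hcoord p i = c * hcoord q i) -> p = q.
Proof.
move=> c0 h; have hp (r : proj_plane K) : val r = <[vpick (val r)]>%VS.
  apply/eqP; rewrite eq_sym eqEdim -memvE memv_pick (eqP (valP r)) dim_vline.
  by rewrite vpick0 -dimv_eq0 (eqP (valP r)).
apply: val_inj; rewrite hp [RHS]hp.
have -> : vpick (val p) = c *: vpick (val q) by apply/rowP => i; rewrite mxE; exact: h.
apply/eqP; rewrite eqEsubv -!memvE memvZ ?memv_line //=.
by apply/vlineP; exists c^-1; rewrite scalerA mulVf // scale1r.
Qed.

Lemma point_of_coord (x : 'I_3 -> K) : (exists i, x i != 0) ->
  exists p : proj_plane K, exists2 c, c != 0 & forall i, hcoord p i = c * x i.
Proof.
move=> [i xi]; pose w := \row_k x k.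
have w0 : w != 0 by apply: contraNneq xi => /rowP/(_ i); rewrite !mxE => ->.
have hw : \dim <[w]>%VS == 1%N by rewrite dim_vline w0.
pose p : proj_plane K := exist _ <[w]>%VS hw; exists p.
have /vlineP[c hc] : vpick (val p) \in <[w]>%VS by exact: memv_pick.
have hcx k : hcoord p k = c * x k by rewrite /hcoord hc !mxE.
exists c => //; have [k] := hcoord_neq0 p; rewrite hcx.
by apply: contraNneq => ->; rewrite mul0r.
Qed.

(** Search along the curve [(1, y, y^2)]: each condition excludes the roots of a nonzero polynomial
    in [y], and their product has a non-root. *)
Lemma exists_nonorthogonal (I : finType) (P : {set I}) (ga : I -> 'I_3 -> K) :
  (forall i, i \in P -> exists k, ga i k != 0) ->
  exists x : 'I_3 -> K, forall i, i \in P -> \sum_k x k * ga i k != 0.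
Proof.
move=> hga; pose g i : {poly K} := \sum_k ga i k *: 'X^k.
have g0 : \prod_(i in P) g i != 0.
  rewrite prodf_seq_neq0; apply/allP => i _; apply/implyP => /hga[k].
  apply: contraNneq => /(congr1 (fun q : {poly K} => q`_k)).
  rewrite coef_sum coef0 (bigD1 k) //= big1 => [|j /negbTE jk].
    by rewrite coefZ coefXn eqxx mulr1 addr0 => ->.
  by rewrite coefZ coefXn eq_sym (inj_eq val_inj) jk mulr0.
have /closed_nonrootP[y] := g0; rewrite rootE horner_prod prodf_seq_neq0 => /allP hy.
exists (fun k : 'I_3 => y ^+ k) => i iP.
have /implyP/(_ iP) := hy i (mem_index_enum _); rewrite /g horner_sum.
by under eq_bigr do rewrite hornerZ hornerXn mulrC.
Qed.

(** The form [ga] kills [v] but not [e], so the two are independent; some standard basis vector lies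
    outside their span and becomes the middle row. *)
Lemma complete_frame (e v ga : 'I_3 -> K) : (exists k, v k != 0) ->
  \sum_k e k * ga k != 0 -> \sum_k v k * ga k = 0 ->
  exists2 E : 'M[K]_3, E \in unitmx & E o0 =1 e /\ E o2 =1 v.
Proof.
move=> [k0 vk0] ega vga; pose M := col_mx (\row_k e k) (\row_k v k).
have [i hi] : exists i : 'I_3, ~~ ((delta_mx 0 i : 'rV[K]_3) <= M)%MS.
  apply/existsP; rewrite -negb_forall; apply/negP => /forallP h.
  have : (1%:M <= M)%MS by apply/row_subP => i; rewrite row1.
  by move=> /mxrankS; rewrite mxrank1 => h3; have := leq_trans h3 (rank_leq_row M).
pose E := \matrix_(j < 3, k < 3)
  (if j == o0 then e k else if j == o2 then v k else (i == k)%:R).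
exists E; last by split=> k; rewrite mxE.
rewrite -row_free_unit -kermx_eq0; apply/eqP/row_matrixP => a; rewrite row0.
set u := row a _; have hu k : u 0 o0 * e k + u 0 o1 * (i == k)%:R + u 0 o2 * v k = 0.
  have : u *m E = 0 by apply/sub_kermxP; rewrite row_sub.
  by move/matrixP/(_ 0 k); rewrite mxE big_ord3 !mxE.
clearbody u; have u1 : u 0 o1 = 0.
  apply/eqP; apply: contraNT hi => u1.
  apply/submxP; exists (row_mx (- (u 0 o0 / u 0 o1))%:M (- (u 0 o2 / u 0 o1))%:M).
  rewrite mul_row_col !mul_scalar_mx; apply/rowP => k; rewrite !mxE eqxx /=.
  apply: (mulfI u1); apply/eqP; rewrite -subr_eq0 -(hu k) [k == i]eq_sym eq_sym.
  by apply/eqP; field.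
have u0 : u 0 o0 = 0.
  have : \sum_k (u 0 o0 * e k + u 0 o1 * (i == k)%:R + u 0 o2 * v k) * ga k = 0.
    by apply: big1 => k _; rewrite hu mul0r.
  under eq_bigr do rewrite u1 mul0r addr0 mulrDl -!mulrA.
  rewrite big_split /= -!mulr_sumr vga mulr0 addr0 => /eqP.
  by rewrite mulf_eq0 (negbTE ega) orbF => /eqP.
have u2 : u 0 o2 = 0.
  move/eqP: (hu k0); rewrite u0 u1 !mul0r !add0r mulf_eq0 (negbTE vk0) orbF.
  by move/eqP.
apply/rowP => k; rewrite [RHS]mxE; case: k => [[|[|[|//]]] hk].
- by rewrite -[RHS]u0; congr (u _ _); apply: val_inj.
- by rewrite -[RHS]u1; congr (u _ _); apply: val_inj.
- by rewrite -[RHS]u2; congr (u _ _); apply: val_inj.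
Qed.

End Frames.

Section Gradient.
Variable K : numClosedFieldType.

Definition gradient (f : {mpoly K[3]}) (p : proj_plane K) (k : 'I_3) : K :=
  (mderiv k f).@[hcoord p].

Lemma line_equation (f : {mpoly K[3]}) : is_line f ->
  exists a : 'I_3 -> K, [/\ exists k, a k != 0,
    forall p, vanishes f p = (\sum_k hcoord p k * a k == 0)
  & forall p k, gradient f p k = a k].
Proof.
move=> [hf f0]; exists (fun k => f@_U_(k)); split=> [|p|p k].
- apply: contra_neqP f0 => h; rewrite [f]mpolyE big_seq big1 // => m hm.
  have /eqP/mdeg1P[k /eqP mE] := dhomog_mf hf hm.
  have : f@_U_(k) = 0 by apply/eqP/negPn/negP => hk; apply: h; exists k.
  by rewrite -mE => ->; rewrite scale0r.
- by rewrite /vanishes linear_form_eval.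
rewrite /gradient (dhomog0_const (dhomog_mderiv k hf)) mevalC mcoeff_mderiv add0m.
by rewrite mnm0E mulr1n.
Qed.

Lemma smooth_conic_gradient (f : {mpoly K[3]}) p :
  is_smooth_conic f -> exists k, gradient f p k != 0.
Proof.
move=> [_ hS]; apply/existsP; apply: contraT => /existsPn h.
have : Sing f p by move=> k; have := h k; rewrite negbK.
by rewrite hS.
Qed.

Lemma tangent_line_gradient (f g : {mpoly K[3]}) (p : proj_plane K) (c : K) : c != 0 ->
  (forall k, gradient f p k = c * gradient g p k) -> tangent_line f p = tangent_line g p.
Proof.
move=> c0 h; apply/seteqP; split=> q; rewrite /tangent_line /=.
  under eq_bigr do rewrite -/(gradient _ _ _) h -mulrA.
  by rewrite -mulr_sumr => /eqP; rewrite mulf_eq0 (negbTE c0) => /eqP.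
move=> hq; under eq_bigr do rewrite -/(gradient _ _ _) h -mulrA.
by rewrite -mulr_sumr hq mulr0.
Qed.

End Gradient.

(** * From ordinary points to tangent cones *)

Section Ordinary.
Variables (K : numClosedFieldType) (I : finType) (A : I -> {mpoly K[3]}).
Hypothesis hA : is_arrangement A.

Lemma curve_homog i : exists k, A i \is k.+1.-homog.
Proof. by have [[h _]|[h _]] := hA.1 i; [exists 0%N|exists 1%N]. Qed.

Lemma arr_poly_homog : exists k, arr_poly A \is k.-homog.
Proof.
have [D hD] := choice curve_homog.
by eexists; apply: dhomog_prodr => i _; exact: hD.
Qed.

Lemma curve_gradient i p : exists k, gradient (A i) p k != 0.
Proof.
have [/line_equation[a [[k ak] _ aE]]|] := hA.1 i; first by exists k; rewrite aE.
exact: smooth_conic_gradient.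
Qed.

Lemma gradient_orthogonal i p : vanishes (A i) p ->
  \sum_k hcoord p k * gradient (A i) p k = 0.
Proof.
by have [k hk] := curve_homog i; rewrite (euler_eval _ hk) => /eqP ->; rewrite mul0rn.
Qed.

Lemma arr_multE p : arr_mult A p = #|[set i | vanishes (A i) p]|.
Proof. by apply: eq_card => i; rewrite inE; apply/idP/idP; rewrite in_setE. Qed.

Lemma tjurina_ordinary p r : (2 <= r <= 4)%N -> ordinary_singularity A p r ->
  tjurina (arr_poly A) p = (r.-1 ^ 2)%N.
Proof.
move=> /andP[r2 r4] [_ mult_p tan_p]; pose S := [set i | vanishes (A i) p].
have cardS : #|S| = r by rewrite -arr_multE.
have [i0 i0S] : exists i0, i0 \in S by apply/card_gt0P; rewrite cardS; apply: leq_trans r2.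
(* A direction tangent to none of the curves through [p]; it makes every [al i] below nonzero. *)
have [e he] := @exists_nonorthogonal K I S (fun i => gradient (A i) p)
  (fun i _ => curve_gradient i p).
have vanS i : i \in S -> vanishes (A i) p by rewrite inE.
have [E E_unit [E0 E2]] := complete_frame (hcoord_neq0 p) (he _ i0S)
  (gradient_orthogonal (vanS i0 i0S)).
pose al i := \sum_k E o0 k * gradient (A i) p k.
pose be i := \sum_k E o1 k * gradient (A i) p k.
have dirE j i : (dirder E j (A i)).@[E o2] = \sum_k E j k * gradient (A i) p k.
  rewrite dirder.unlock raddf_sum; apply: eq_bigr => k _.
  by rewrite /= mevalZ (meval_eq _ E2).
have al_neq0 i : i \in S -> al i != 0.
  by move=> iS; have := he _ iS; rewrite /al; under [in X in _ -> X]eq_bigr do rewrite E0.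
have bl0 i : i \in S -> (blowup E (A i))`_0 = 0.
  by move=> /vanS hi; rewrite coef0_blowup (meval_eq _ E2) (eqP hi).
have bl1 i : (blowup E (A i))`_1 = 'X * (al i)%:P + (be i)%:P.
  have := congr1 (fun q : {poly {poly K}} => q`_0) (deriv_blowup E (A i)).
  by rewrite coef_deriv mulr1n coefD coefCM !coef0_blowup !dirE.
(* Otherwise [w] is killed by the whole frame, the third row being [p] itself; the gradients are
   then proportional and the tangent lines coincide. *)
have not_prop i j : i \in S -> j \in S -> i != j -> al i * be j != al j * be i.
  move=> iS jS ij; apply/eqP => hab; apply: (tan_p i j ij (vanS _ iS) (vanS _ jS)).
  apply: (@tangent_line_gradient _ _ _ _ (al i / al j)) => [|k].
    by rewrite mulf_neq0 ?invr_eq0 ?al_neq0.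
  pose w : 'cV[K]_3 := \col_k (al j * gradient (A i) p k - al i * gradient (A j) p k).
  have Ew : E *m w = 0.
    apply/colP => l; rewrite !mxE.
    have -> : \sum_k E l k * w k 0 = al j * (\sum_k E l k * gradient (A i) p k)
        - al i * (\sum_k E l k * gradient (A j) p k).
      rewrite !mulr_sumr -sumrB; apply: eq_bigr => m _; rewrite mxE; ring.
    case: l => [[|[|[|//]]] hl].
    - rewrite (_ : Ordinal hl = o0); last exact: val_inj.
      by rewrite -/(al i) -/(al j) mulrC subrr.
    - rewrite (_ : Ordinal hl = o1); last exact: val_inj.
      by rewrite -/(be i) -/(be j) hab subrr.
    rewrite (_ : Ordinal hl = o2); last exact: val_inj.
    under eq_bigr do rewrite E2; under [X in _ - _ * X]eq_bigr do rewrite E2.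
    by rewrite !gradient_orthogonal ?vanS // !mulr0 subrr.
  have w0 : w = 0 by rewrite -[w](mulKmx E_unit) Ew mulmx0.
  have /matrixP/(_ k 0) := w0; rewrite !mxE => /eqP; rewrite subr_eq0 => /eqP hk.
  apply: (mulfI (al_neq0 j jS)); rewrite hk !mulrA; congr (_ * _).
  by rewrite [al j * _]mulrC mulfK // al_neq0.
have [k F_homog] := arr_poly_homog.
have FE : arr_poly A = (\prod_(i in S) A i) * \prod_(i in ~: S) A i.
  by rewrite /arr_poly (bigID (mem S)) /=; congr (_ * _); apply: eq_bigl => i; rewrite !inE.
have bl_prod (P : {set I}) : blowup E (\prod_(i in P) A i) = \prod_(i in P) blowup E (A i).
  exact: (big_morph _ (blowupM E) (blowup1 E)).
have [ordS leadS] := prod_order bl0; rewrite cardS -bl_prod in ordS leadS.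
(* The curves not through [p] only scale the tangent cone by a nonzero constant. *)
pose c := (\prod_(i in ~: S) A i).@[E o2].
have c0 : c != 0.
  rewrite /c rmorph_prod prodf_seq_neq0; apply/allP => i _; apply/implyP.
  by rewrite !inE /= (meval_eq _ E2).
have cE : (blowup E (\prod_(i in ~: S) A i))`_0 = c%:P by rewrite coef0_blowup.
have rE : r = r.-1.+1 by rewrite prednK // ltnW.
have F_order : eq_upto r (blowup E (arr_poly A)) 0.
  rewrite FE blowupM -[X in eq_upto _ _ X](mul0r (blowup E (\prod_(i in ~: S) A i))).
  exact: eq_uptoM.
have F_lead : (blowup E (arr_poly A))`_r =
    (\prod_(i in S) ('X * (al i)%:P + (be i)%:P)) * c%:P.
  rewrite FE blowupM coefM big_ord_recr /= subnn cE leadS big1 ?add0r.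
    by congr (_ * _); apply: eq_bigr => i _; rewrite bl1.
  by move=> i _; rewrite ordS // coef0 mul0r.
apply: (tjurina_of_tangent_cone E_unit E2 F_homog).
- by rewrite -ltnS -rE.
- by rewrite -ltnS -rE.
- by rewrite -rE.
rewrite -rE F_lead -cardS => u w su sw.
apply: no_syzygy_of_distinct_tangents => //.
by rewrite cardS; apply: leq_trans r2.
Qed.

End Ordinary.

(** * Intersections of lines and conics *)

Lemma ord3P (P : 'I_3 -> Prop) : P o0 -> P o1 -> P o2 -> forall k, P k.
Proof.
move=> P0 P1 P2 [[|[|[|//]]] hk].
- by rewrite (_ : Ordinal hk = o0) //; apply: val_inj.
- by rewrite (_ : Ordinal hk = o1) //; apply: val_inj.
- by rewrite (_ : Ordinal hk = o2) //; apply: val_inj.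
Qed.

Section Intersections.
Variable K : numClosedFieldType.
Implicit Types (c v w x y : 'I_3 -> K) (p q : proj_plane K).

Lemma cross_product (a b : 'I_3 -> K) : exists x : 'I_3 -> K,
  [/\ \sum_k x k * a k = 0, \sum_k x k * b k = 0,
    (forall k, x k = 0) -> forall k l, a k * b l = a l * b k
  & forall y : 'I_3 -> K, \sum_k y k * a k = 0 -> \sum_k y k * b k = 0 ->
    forall k l, x k * y l = x l * y k].
Proof.
have [x [x0 x1 x2]] : exists x : 'I_3 -> K, [/\ x o0 = a o1 * b o2 - a o2 * b o1,
    x o1 = a o2 * b o0 - a o0 * b o2 & x o2 = a o0 * b o1 - a o1 * b o0].
  by exists (fun k => if k == o0 then a o1 * b o2 - a o2 * b o1
    else if k == o1 then a o2 * b o0 - a o0 * b o2 else a o0 * b o1 - a o1 * b o0).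
exists x; rewrite !big_ord3; split.
- by rewrite x0 x1 x2; ring.
- by rewrite x0 x1 x2; ring.
- move=> hx; apply: ord3P; apply: ord3P => //; apply/eqP; rewrite -subr_eq0.
  + by rewrite -x2 hx.
  + by rewrite -opprB -x1 hx oppr0.
  + by rewrite -opprB -x2 hx oppr0.
  + by rewrite -x0 hx.
  + by rewrite -x1 hx.
  + by rewrite -opprB -x0 hx oppr0.
move=> y; rewrite !big_ord3 => ya yb.
(* These are the coordinates of the triple product [(a x b) x y], which are also the minors of [x]
   and [y]. *)
have e k : b k * (y o0 * a o0 + y o1 * a o1 + y o2 * a o2)
    - a k * (y o0 * b o0 + y o1 * b o1 + y o2 * b o2) = 0.
  by rewrite ya yb !mulr0 subrr.
apply: ord3P; apply: ord3P => //; apply/eqP; rewrite -subr_eq0; apply/eqP.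
- by rewrite -(e o2) x0 x1; ring.
- by rewrite -[RHS]oppr0 -(e o1) x0 x2; ring.
- by rewrite -[RHS]oppr0 -(e o2) x0 x1; ring.
- by rewrite -(e o0) x1 x2; ring.
- by rewrite -(e o1) x0 x2; ring.
- by rewrite -[RHS]oppr0 -(e o0) x1 x2; ring.
Qed.

Lemma hcoord_proportional p x k : x k != 0 ->
  (forall j, x k * hcoord p j = x j * hcoord p k) ->
  exists2 a, a != 0 & forall j, hcoord p j = a * x j.
Proof.
move=> xk h; exists (hcoord p k / x k) => [|j].
  rewrite mulf_neq0 ?invr_eq0 //; have [j hj] := hcoord_neq0 p.
  apply: contraNneq hj => e; have := h j; rewrite e mulr0 => /eqP.
  by rewrite mulf_eq0 (negbTE xk).
by apply: (mulfI xk); rewrite h; field.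
Qed.

(** The point is the cross product of the two coefficient vectors; if that were zero, the vectors
    would be proportional and the lines equal. *)
Lemma line_line_point (f g : {mpoly K[3]}) : is_line f -> is_line g ->
  zero_locus f <> zero_locus g ->
  exists p, forall q, (vanishes f q && vanishes g q) = (q == p).
Proof.
move=> /line_equation[a [[i ai] fE _]] /line_equation[b [[j bj] gE _]] fg.
have [x [xa xb x0 cross]] := cross_product a b.
have [k xk] : exists k, x k != 0.
  apply/existsP; apply: contra_notT fg => /existsPn hx.
  have minor : forall k l, a k * b l = a l * b k.
    by apply: x0 => k; apply/eqP; have := hx k; rewrite negbK.
  have bE l : b l = b i / a i * a l by apply: (mulfI ai); rewrite (minor i l); field.
  have bi : b i != 0 by apply: contraNneq bj => bi; rewrite bE bi !mul0r.
  have gfE q : \sum_k hcoord q k * b k = b i / a i * \sum_k hcoord q k * a k.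
    by rewrite mulr_sumr; apply: eq_bigr => l _; rewrite bE mulrCA.
  apply/seteqP; split=> q; rewrite /zero_locus /= fE gE gfE.
    by move=> /eqP ->; rewrite mulr0.
  by rewrite mulf_eq0 mulf_eq0 invr_eq0 (negbTE bi) (negbTE ai).
have [p [s s0 hp]] := point_of_coord (ex_intro _ k xk).
have pE (c : 'I_3 -> K) : \sum_k hcoord p k * c k = s * \sum_k x k * c k.
  by rewrite mulr_sumr; apply: eq_bigr => l _; rewrite hp mulrA.
exists p => q; rewrite fE gE.
apply/andP/eqP => [[/eqP fq /eqP gq]|->]; last by rewrite !pE xa xb mulr0.
have [t t0 ht] := hcoord_proportional xk (cross _ fq gq k).
apply: (@proj_planeP _ _ _ (t / s)) => [|l]; first by rewrite mulf_neq0 ?invr_eq0.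
by rewrite ht hp mulrA divfK.
Qed.

(** [v] and [w] parametrize the line [c = 0]. The last clause, that a form vanishing on both is a
    multiple of [c], is how tangency is recognized. *)
Lemma line_frame c v : (exists k, c k != 0) -> (exists k, v k != 0) ->
  \sum_k v k * c k = 0 ->
  exists w, [/\ \sum_k w k * c k = 0,
    forall a b, (forall k, a * v k + b * w k = 0) -> a = 0 /\ b = 0,
    forall x, \sum_k x k * c k = 0 -> exists a b, forall k, x k = a * v k + b * w k
  & forall g, \sum_k v k * g k = 0 -> \sum_k w k * g k = 0 ->
      exists t, forall k, g k = t * c k].
Proof.
move=> [k0 ck0] v0 vc.
pose e (k : 'I_3) : K := (k == k0)%:R.
have ec : \sum_k e k * c k = c k0.
  rewrite (bigD1 k0) //= /e eqxx mul1r big1 ?addr0 // => k /negbTE ->.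
  by rewrite mul0r.
have [||E E_unit [E0 E2]] := @complete_frame K e v c v0; rewrite ?ec //.
(* Chosen so that subtracting [s e] moves the middle row onto the line. *)
pose s := (\sum_k E o1 k * c k) / c k0.
pose w k := E o1 k - s * e k.
have wc : \sum_k w k * c k = 0.
  rewrite /w; under eq_bigr do rewrite mulrBl -mulrA.
  by rewrite sumrB -mulr_sumr ec divfK // subrr.
have uE (u : 'rV[K]_3) k :
    (u *m E) 0 k = u 0 o0 * e k + u 0 o1 * E o1 k + u 0 o2 * v k.
  by rewrite mxE big_ord3 E0 E2.
exists w; split=> //.
- move=> a b hab; pose u : 'rV[K]_3 :=
    \row_k (if k == o0 then - (b * s) else if k == o1 then b else a).
  have u0 : u = 0.
    rewrite -[u](mulmxK E_unit); rewrite (_ : u *m E = 0) ?mul0mx //.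
    apply/rowP => k; rewrite uE !mxE /=; have := hab k; rewrite /w => <-; ring.
  by have := congr1 (fun u : 'rV[K]_3 => (u 0 o2, u 0 o1)) u0; rewrite !mxE => -[-> ->].
- move=> x xc; pose u := (\row_k x k) *m invmx E.
  have xE k : x k = u 0 o0 * e k + u 0 o1 * E o1 k + u 0 o2 * v k.
    by rewrite -uE /u mulmxKV // mxE.
  have u0 : u 0 o0 + u 0 o1 * s = 0.
    apply: (mulIf ck0); rewrite mul0r mulrDl -mulrA divfK // -[RHS]xc.
    under [in RHS]eq_bigr do rewrite xE !mulrDl -!mulrA.
    by rewrite !big_split /= -!mulr_sumr ec vc mulr0 addr0.
  exists (u 0 o2), (u 0 o1) => k; rewrite xE /w.
  by move/eqP: u0; rewrite addr_eq0 => /eqP ->; ring.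
move=> g vg wg; exists (g k0 / c k0) => k.
pose h k := g k - g k0 / c k0 * c k.
have eg : \sum_k e k * g k = g k0.
  rewrite (bigD1 k0) //= /e eqxx mul1r big1 ?addr0 // => j /negbTE ->.
  by rewrite mul0r.
have h0 : E *m (\col_k h k) = 0.
  have hl l : (E *m (\col_k h k)) l 0 =
      (\sum_k E l k * g k) - g k0 / c k0 * (\sum_k E l k * c k).
    rewrite mxE mulr_sumr -sumrB; apply: eq_bigr => j _; rewrite mxE /h; ring.
  have s1 : \sum_k E o1 k * c k = s * c k0 by rewrite divfK.
  have s2 : \sum_k E o1 k * g k = s * g k0.
    move: wg; rewrite /w; under eq_bigr do rewrite mulrBl -mulrA.
    by rewrite sumrB -mulr_sumr eg => /subr0_eq.
  apply/colP => l; rewrite hl [RHS]mxE; case: l => [[|[|[|//]]] hk].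
  - rewrite (_ : Ordinal hk = o0); last exact: val_inj.
    under eq_bigr do rewrite E0; under [X in _ - _ * X]eq_bigr do rewrite E0.
    by rewrite eg ec divfK // subrr.
  - rewrite (_ : Ordinal hk = o1); last exact: val_inj.
    by rewrite s1 s2; field.
  rewrite (_ : Ordinal hk = o2); last exact: val_inj.
  under eq_bigr do rewrite E2; under [X in _ - _ * X]eq_bigr do rewrite E2.
  by rewrite vg vc mulr0 subrr.
have : \col_k h k = 0 by rewrite -[LHS](mulKmx E_unit) h0 mulmx0.
by move/matrixP/(_ k 0); rewrite !mxE => /subr0_eq.
Qed.

(** Either the chosen point [v] of the line is on [Q], or [Q(w + l v)] has degree exactly 2 in [l]
    and hence a root. *)
Lemma line_meets_conic (f Q : {mpoly K[3]}) : is_line f -> Q \is 2.-homog ->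
  exists p, vanishes f p && vanishes Q p.
Proof.
move=> /line_equation[c [cf fE _]] hQ.
have [v v0 vc] : exists2 v, (exists k, v k != 0) & \sum_k v k * c k = 0.
  have [c0|c0] := eqVneq (c o0) 0.
    exists (fun k => (k == o0)%:R); first by exists o0; rewrite eqxx oner_neq0.
    by rewrite big_ord3 c0 /= !mul0r mulr0 !addr0.
  exists (fun k => if k == o0 then - c o1 else if k == o1 then c o0 else 0).
    by exists o1.
  by rewrite big_ord3 /= mul0r; ring.
have [w [wc indep _ _]] := line_frame cf v0 vc.
have [x x0 [xc xQ]] : exists2 x, (exists k, x k != 0) & \sum_k x k * c k = 0 /\ Q.@[x] = 0.
  have [Qv|Qv] := eqVneq Q.@[v] 0; first by exists v.
  pose B := \sum_k (mderiv k Q).@[w] * v k.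
  pose P : {poly K} := Poly [:: Q.@[w]; B; Q.@[v]].
  have sP : size P = 3%N by rewrite (PolyK (c := 0)).
  have [|l /rootP hl] := closed_rootP P _; first by rewrite sP.
  exists (fun k => w k + l * v k); last split.
  - apply/existsP; apply: contraT => /existsPn h.
    have [|_ /eqP] := indep l 1; last by rewrite oner_eq0.
    by move=> k; have := h k; rewrite negbK mul1r addrC => /eqP.
  - under eq_bigr do rewrite mulrDl -mulrA.
    by rewrite big_split /= -mulr_sumr wc vc mulr0 addr0.
  rewrite quadratic_form_eval // -/B -hl horner_Poly /= mul0r add0r expr2; ring.
have [p [t t0 hp]] := point_of_coord x0; exists p.
rewrite fE (eq_bigr (fun k => t * (x k * c k))) => [|k _].
  rewrite -mulr_sumr xc mulr0 eqxx /vanishes (meval_eq _ hp).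
  by rewrite (meval_scale _ _ hQ) xQ mulr0 eqxx.
by rewrite hp mulrA.
Qed.

(** With [v] on the conic, [Q(a v + b w) = b (a B + b Q(w))], where [B] is the derivative of [Q] at
    [v] along the line. Since [B] is nonzero, the second root [(Q(w) : -B)] differs from the
    first. *)
Lemma line_conic_points (f Q : {mpoly K[3]}) : is_line f -> is_smooth_conic Q ->
  (forall p, vanishes f p -> vanishes Q p -> tangent_line f p <> tangent_line Q p) ->
  exists p1 p2, p1 != p2 /\
    forall q, (vanishes f q && vanishes Q q) = (q \in [:: p1; p2]).
Proof.
move=> lf cQ htan; have hQ := cQ.1.
have [p1 /andP[fp1 Qp1]] := line_meets_conic lf hQ.
have [c [cf fE fgrad]] := line_equation lf; pose v := hcoord p1.
have vc : \sum_k v k * c k = 0 by apply/eqP; rewrite -fE.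
have [w [wc indep onl forms]] := line_frame cf (hcoord_neq0 p1) vc.
have Qv : Q.@[v] = 0 by apply/eqP.
pose B := \sum_k (mderiv k Q).@[v] * w k.
have QE a b : Q.@[fun k => a * v k + b * w k] = b * (a * B + b * Q.@[w]).
  rewrite (quadratic_form_eval (fun k => a * v k)) // (meval_scale _ _ hQ) Qv mulr0 add0r.
  rewrite (eq_bigr (fun k => a * ((mderiv k Q).@[v] * w k))) => [|k _].
    by rewrite -mulr_sumr -/B; ring.
  by rewrite (meval_scale _ _ (dhomog_mderiv k hQ)) expr1 mulrA.
have B0 : B != 0.
  (* If [B = 0], the gradient of [Q] kills [v] and [w], so it is a multiple of [c] and the tangent
     lines coincide. *)
  apply/eqP => B0.
  have [||t ht] := forms (gradient Q p1).
  - by have := euler_eval v hQ; rewrite Qv mul0rn.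
  - by rewrite -[RHS]B0; apply: eq_bigr => k _; rewrite mulrC.
  have t0 : t != 0.
    have [k] := smooth_conic_gradient p1 cQ.
    by apply: contraNneq => t0; rewrite ht t0 mul0r.
  apply: (htan p1 fp1 Qp1); symmetry; apply: (tangent_line_gradient t0) => k.
  by rewrite ht fgrad.
pose y k := Q.@[w] * v k + (- B) * w k.
have y0 : exists k, y k != 0.
  apply/existsP; apply: contraT => /existsPn h.
  have [|_ /eqP] := indep Q.@[w] (- B); last by rewrite oppr_eq0 (negbTE B0).
  by move=> k; have := h k; rewrite negbK => /eqP.
have [p2 [t t0 hp2]] := point_of_coord y0.
exists p1, p2; split.
  apply/eqP => e; have [|_ /eqP] := indep (1 - t * Q.@[w]) (t * B).
    move=> k; have hk : v k = t * y k by rewrite /v e.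
    by rewrite -/v mulrBl mul1r {1}hk /y; ring.
  by rewrite mulf_eq0 (negbTE t0) (negbTE B0).
move=> q; rewrite !inE; apply/andP/orP; last first.
  case=> /eqP -> //; rewrite fE /vanishes (meval_eq _ hp2).
  rewrite (meval_scale _ _ hQ) QE; split; last by apply/eqP; ring.
  rewrite (eq_bigr (fun k => t * (Q.@[w] * (v k * c k) - B * (w k * c k)))) => [|k _].
    by rewrite -mulr_sumr sumrB -!mulr_sumr vc wc !mulr0 subrr mulr0.
  by rewrite hp2 /y; ring.
rewrite fE => -[/eqP /onl[a [b hab]]].
rewrite /vanishes (meval_eq _ hab) QE mulf_eq0.
have nz : (a != 0) || (b != 0).
  have [k] := hcoord_neq0 q; apply: contraNT; rewrite negb_or !negbK hab.
  by move=> /andP[/eqP -> /eqP ->]; rewrite !mul0r addr0.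
have [b0 _|b0 /= /eqP hB] := eqVneq b 0.
  left; apply/eqP; rewrite b0 eqxx orbF in nz.
  by apply: (proj_planeP nz) => k; rewrite hab b0 mul0r addr0.
right; apply/eqP; apply: (@proj_planeP _ _ _ (- (b / B) / t)) => [|k].
  by rewrite !mulf_neq0 ?oppr_eq0 ?mulf_neq0 ?invr_eq0.
rewrite hp2 mulrA divfK // hab /y.
have -> : a = - (b / B) * Q.@[w].
  by apply: (mulIf B0); move/eqP: hB; rewrite addr_eq0 => /eqP ->; field.
by rewrite -/(v k); field.
Qed.

End Intersections.

(** * Counting multiple points *)

Section PointCount.
Variables (K : numClosedFieldType) (I : finType) (A : I -> {mpoly K[3]}).
Hypothesis hA : is_arrangement A.
Hypothesis I_gt0 : (0 < #|I|)%N.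

(** At a point of [A i] the product rule leaves the gradient of [A i], which is nonzero, times the
    value of the product of the other curves. *)
Lemma Sing_arr_poly p : Sing (arr_poly A) p <-> (1 < arr_mult A p)%N.
Proof.
rewrite arr_multE.
have hF i : arr_poly A = A i * \prod_(j | j != i) A j by rewrite /arr_poly (bigD1 i).
have prod_eq0 (P : pred I) : (\prod_(j | P j) A j).@[hcoord p] = 0 <->
    exists2 j, P j & vanishes (A j) p.
  rewrite rmorph_prod; split=> [/eqP|[j Pj /eqP hj]]; last by rewrite (bigD1 j) //= hj mul0r.
  by rewrite prodf_seq_eq0 => /hasP[j _ /andP[Pj hj]]; exists j.
have dF i k : vanishes (A i) p -> (mderiv k (arr_poly A)).@[hcoord p] =
    gradient (A i) p k * (\prod_(j | j != i) A j).@[hcoord p].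
  by move=> /eqP hi; rewrite (hF i) mderivM mevalD !mevalM hi mul0r addr0.
split=> [hS|/card_gt1P[i [j [iS jS ij]]] k]; last first.
  rewrite !inE in iS jS; apply/eqP; rewrite (dF i) // (prod_eq0 _).2 ?mulr0 //.
  by exists j; rewrite // eq_sym.
(* Euler's formula puts [p] on the union; the degree is positive because there is at least one
   curve. *)
have [i iS] : exists i, vanishes (A i) p.
  have [D hD] := choice (curve_homog hA).
  have F_homog : arr_poly A \is (\sum_i (D i).+1)%N.-homog.
    by apply: dhomog_prodr => i _; exact: hD.
  have := euler_eval (hcoord p) F_homog.
  rewrite big1 => [|k _]; last by rewrite (eqP (hS k)) mulr0.
  move=> /esym/eqP; rewrite mulrn_eq0 => /orP[|/eqP/(prod_eq0 xpredT)[i _ hi]]; last by exists i.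
  by have /card_gt0P[i _] := I_gt0; rewrite (bigD1 i).
have [k hk] := curve_gradient hA i p.
have := hS k; rewrite /vanishes (dF i k iS) mulf_eq0 (negbTE hk) => /eqP/prod_eq0[j ji jS].
by apply/card_gt1P; exists i, j; split; rewrite ?inE // eq_sym.
Qed.

Variable common : I -> I -> seq (proj_plane K).
Hypothesis common_uniq : forall i j, uniq (common i j).
Hypothesis commonE : forall i j, i != j ->
  forall q, (vanishes (A i) q && vanishes (A j) q) = (q \in common i j).

Definition multiple_points : seq (proj_plane K) :=
  undup [seq p | ij <- enum [pred ij : I * I | ij.1 != ij.2], p <- common ij.1 ij.2].

Lemma mem_multiple_points p : (p \in multiple_points) = (1 < arr_mult A p)%N.
Proof.
rewrite mem_undup arr_multE; apply/allpairsPdep/card_gt1P.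
  move=> [[i j] [q [hij hq ->]]]; rewrite mem_enum inE /= in hij hq.
  have := commonE hij q; rewrite hq => /andP[iS jS].
  by exists i, j; split; rewrite ?inE.
move=> [i [j [iS jS ij]]]; rewrite !inE in iS jS.
by exists (i, j), p; rewrite mem_enum inE /= -commonE // iS jS.
Qed.

(** Points of multiplicity above 1 lie in a finite list, so [fset_set] does not take its default
    value. *)
Lemma num_points_count r : (1 < r)%N ->
  num_points A r = count (fun p => arr_mult A p == r) multiple_points.
Proof.
move=> r1; rewrite /num_points -size_filter.
have u : uniq [seq p <- multiple_points | arr_mult A p == r] by rewrite filter_uniq ?undup_uniq.
rewrite -[in RHS](undup_id u) -card_fseq -[in RHS](set_fsetK [fset x in _]%fset).
congr #|` fset_set _|; apply/seteqP; split=> p /=; rewrite !inE /= mem_filter mem_multiple_points.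
  by move=> ->; rewrite eqxx.
by move=> /andP[/eqP].
Qed.

Lemma jacobian_degree_sum :
  jacobian_degree (arr_poly A) = (\sum_(p <- multiple_points) tjurina (arr_poly A) p)%N.
Proof.
rewrite fsbig_seq ?undup_uniq // /jacobian_degree; congr (\big[_/_]_(i \in _) _).
apply/seteqP; split=> p /=; rewrite mem_multiple_points.
  by move=> /Sing_arr_poly.
by move=> h; apply/Sing_arr_poly.
Qed.

(** Both sides count the triples of two distinct curves, in order, and a point on both. *)
Lemma sum_common :
  (\sum_i \sum_(j | j != i) size (common i j) =
   \sum_(p <- multiple_points) arr_mult A p * (arr_mult A p).-1)%N.
Proof.
have sizeE i j : j != i -> size (common i j) =
    (\sum_(p <- multiple_points) (vanishes (A i) p && vanishes (A j) p))%N.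
  rewrite eq_sym => ij; rewrite -big_mkcond sum1_count -size_filter; apply/perm_size/uniq_perm.
  - exact: common_uniq.
  - by rewrite filter_uniq ?undup_uniq.
  move=> p; rewrite mem_filter -commonE //; case: (boolP (_ && _)) => // /andP[iS jS].
  by rewrite mem_multiple_points arr_multE; apply/esym/card_gt1P; exists i, j; split; rewrite ?inE.
under eq_bigr do under eq_bigr => j ji do rewrite (sizeE _ _ ji).
under eq_bigr do rewrite exchange_big /=.
rewrite exchange_big /=; apply: eq_bigr => p _; rewrite arr_multE.
transitivity (\sum_(i in [set i | vanishes (A i) p]) #|[set i | vanishes (A i) p]|.-1)%N.
  rewrite big_mkcond [RHS]big_mkcond; apply: eq_bigr => i _; rewrite inE.
  case: ifP => hi; last by rewrite big1.
  rewrite (cardsD1 i) inE hi /= -sum1_card big_mkcond [RHS]big_mkcond.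
  by apply: eq_bigr => j _; rewrite !inE; case: (j != i); case: (vanishes _ _).
by rewrite sum_nat_const.
Qed.

Lemma sum_over_multiple_points (f : nat -> nat) :
  (forall p, Sing (arr_poly A) p -> arr_mult A p <= 4)%N ->
  (\sum_(p <- multiple_points) f (arr_mult A p) =
   num_points A 2 * f 2 + num_points A 3 * f 3 + num_points A 4 * f 4)%N.
Proof.
move=> mult_le4; rewrite !num_points_count //.
have : {in multiple_points, forall p, (2 <= arr_mult A p <= 4)%N}.
  by move=> p; rewrite mem_multiple_points => h; rewrite h mult_le4 //; apply/Sing_arr_poly.
elim: multiple_points => [|p s IH] hs; first by rewrite big_nil.
rewrite big_cons IH /= => [|q qs]; last by apply: hs; rewrite inE qs orbT.
have := hs p (mem_head _ _).
by case: (arr_mult A p) => [|[|[|[|[|m]]]]] //= _; lia.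
Qed.

Lemma ordinary_point_count :
  (forall p, Sing (arr_poly A) p -> exists2 r, (r <= 4)%N & ordinary_singularity A p r) ->
  (\sum_i \sum_(j | j != i) size (common i j) =
    2 * num_points A 2 + 6 * num_points A 3 + 12 * num_points A 4 /\
  jacobian_degree (arr_poly A) =
    num_points A 2 + 4 * num_points A 3 + 9 * num_points A 4)%N.
Proof.
move=> ord.
have mult_le4 p : Sing (arr_poly A) p -> (arr_mult A p <= 4)%N.
  by move=> /ord[r r4 [_ ->]].
split.
  by rewrite sum_common (sum_over_multiple_points (fun m => m * m.-1)%N) //; lia.
rewrite jacobian_degree_sum (eq_big_seq (fun p => (arr_mult A p).-1 ^ 2)%N).
  by rewrite (sum_over_multiple_points (fun m => m.-1 ^ 2)%N) //; lia.
move=> p; rewrite mem_multiple_points => hp.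
have [r r4 o] := ord p ((Sing_arr_poly p).2 hp); have [_ e _] := o.
by rewrite e (tjurina_ordinary hA _ o) // -e hp e.
Qed.

End PointCount.

(** * Lines and one conic *)

Section LinesAndConic.
Variables (K : numClosedFieldType) (d : nat).
Variables (L : 'I_d -> {mpoly K[3]}) (Q : {mpoly K[3]}).
Hypothesis hL : forall i, is_line (L i).
Hypothesis hQ : is_smooth_conic Q.

Local Notation A := (oapp L Q).
Hypothesis hM : is_M_arrangement A.

Lemma conic_neq0 : Q != 0.
Proof.
apply/eqP => Q0; have [p _] := @point_of_coord K (fun=> 1) (ex_intro _ o0 (oner_neq0 _)).
have : Sing Q p by move=> i; rewrite Q0 mderiv0 /vanishes meval0.
by rewrite hQ.2.
Qed.

Lemma sum_is_none : (\sum_(i : option 'I_d) (i == None) = 1)%N.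
Proof. by rewrite (bigD1 None) //= big1 // => i /negbTE ->. Qed.

Lemma arr_degreeE : arr_degree A = d.+2.
Proof.
have hF : arr_poly A \is (d.+2).-homog.
  have -> : d.+2 = (\sum_(i : option 'I_d) (1 + (i == None)))%N.
    by rewrite big_split /= sum_is_none sum1_card card_option card_ord addn1.
  apply: dhomog_prodr => -[i|] _ /=; first exact: (hL i).1.
  exact: hQ.1.
have F0 : arr_poly A != 0.
  rewrite prodf_seq_neq0; apply/allP => -[i|] _ /=; first exact: (hL i).2.
  exact: conic_neq0.
exact/esym/(dhomog_uniq F0 hF)/(dhomog_msize hF).
Qed.

Lemma common_points (i j : option 'I_d) : exists s : seq (proj_plane K),
  uniq s /\ (i != j -> size s = (1 + (i == None) + (j == None))%N /\
    forall q, (vanishes (A i) q && vanishes (A j) q) = (q \in s)).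
Proof.
have [hA _ hS _ _] := hM.
have I_gt0 : (0 < #|{: option 'I_d}|)%N by rewrite card_option.
(* A common point is singular on the union, hence ordinary, which excludes tangency. *)
have tangent k : forall p, vanishes (L k) p -> vanishes Q p ->
    tangent_line (L k) p <> tangent_line Q p.
  move=> p Lp Qp; have [|r _ [_ _ ordp]] := hS p; last exact: (ordp (Some k) None).
  apply/(Sing_arr_poly hA I_gt0); rewrite arr_multE; apply/card_gt1P.
  by exists (Some k), None; split; rewrite ?inE.
have [->|ij] := eqVneq i j; first by exists [::].
case: i j ij => [i|] [j|] // ij.
- have [|p hp] := line_line_point (hL i) (hL j).
    by move=> e; case/eqP: ij; exact: (hA.2 (Some i) (Some j) e).
  by exists [:: p]; split=> // _; split=> // q; rewrite hp inE.
- have [p1 [p2 [p12 hp]]] := line_conic_points (hL i) hQ (tangent i).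
  exists [:: p1; p2]; split; first by rewrite /= inE p12.
  by [].
have [p1 [p2 [p12 hp]]] := line_conic_points (hL j) hQ (tangent j).
exists [:: p1; p2]; split; first by rewrite /= inE p12.
by split=> // q; rewrite andbC; apply: hp.
Qed.

Lemma point_equations :
  let n2 := num_points A 2 in let n3 := num_points A 3 in let n4 := num_points A 4 in
  let m := (d.+2)./2 in
  (d * d + 3 * d = 2 * n2 + 6 * n3 + 12 * n4 /\
  (if odd d then 3 * m ^ 2 + 1 else 3 * m ^ 2 - 3 * m + 3) = n2 + 4 * n3 + 9 * n4)%N.
Proof.
have [hA _ hS _ hdeg] := hM; rewrite /= arr_degreeE /= negbK in hdeg.
have I_gt0 : (0 < #|{: option 'I_d}|)%N by rewrite card_option.
have [s hs] := choice (fun ij : option 'I_d * option 'I_d => common_points ij.1 ij.2).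
have [sumE degE] := @ordinary_point_count _ _ _ hA I_gt0 (fun i j => s (i, j))
  (fun i j => (hs (i, j)).1) (fun i j ij => ((hs (i, j)).2 ij).2) hS.
split; last by rewrite -hdeg -degE.
have sE (i j : option 'I_d) : j != i -> size (s (i, j)) = (1 + (i == None) + (j == None))%N.
  by rewrite eq_sym => ij; have [-> _] := (hs (i, j)).2 ij.
rewrite -sumE; under eq_bigr do under eq_bigr => j ji do rewrite (sE _ _ ji).
pose f (i j : option 'I_d) := (1 + (i == None) + (j == None))%N.
(* With the diagonal added both sums become unrestricted, and
   [(d + 1)(d + 3) - (d + 3) = d^2 + 3 d], twice the number of intersections of pairs. *)
have diag : (\sum_i \sum_(j | j != i) f i j + \sum_i f i i = \sum_i \sum_j f i j)%N.
  by rewrite -big_split; apply: eq_bigr => i _ /=; rewrite [RHS](bigD1 i) //= addnC.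
have diagE : (\sum_i f i i = d.+3)%N.
  rewrite /f !big_split /= sum_is_none sum1_card card_option card_ord; lia.
have allE : (\sum_i \sum_j f i j = d.+1 * d.+3)%N.
  transitivity (\sum_(i : option 'I_d) (d.+1 * (1 + (i == None)) + 1))%N.
    apply: eq_bigr => i _; rewrite /f big_split /= sum_is_none.
    by rewrite sum_nat_const card_option card_ord.
  rewrite big_split /= -big_distrr /= big_split /= sum_is_none sum1_card card_option card_ord.
  by lia.
by move: diag; rewrite diagE allE /f; lia.
Qed.

End LinesAndConic.

Theorem proposition3p4 (R : realType) (d : nat)
    (L : 'I_d -> {mpoly R[i][3]}) (Q : {mpoly R[i][3]})
    (hd : (3 <= d)%N)
    (hL : forall i, is_line (L i))
    (hQ : is_smooth_conic Q)
    (hM : is_M_arrangement (oapp L Q)) :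
  let n2 := num_points (oapp L Q) 2 in
  let n3 := num_points (oapp L Q) 3 in
  let n4 := num_points (oapp L Q) 4 in
  (forall l : nat, d = (2 * l)%N ->
     (n2 + n3 = 3 * l - 6)%N /\ (n3 + 3 * n4 = l ^ 2 + 3)%N) /\
  (forall l : nat, d = (2 * l + 1)%N ->
     (n2 + n3 = 3 * l - 2)%N /\ (n3 + 3 * n4 = l ^ 2 + l + 2)%N).
Proof.
move=> n2 n3 n4; have [] := point_equations hL hQ hM; rewrite -/n2 -/n3 -/n4.
move: n2 n3 n4 => n2 n3 n4 pairs degree.
have half l : (2 * l).+2./2 = l.+1 by rewrite mul2n -doubleS doubleK.
have half' l : (2 * l + 1).+2./2 = l.+1.
  by rewrite mul2n addn1 -doubleS; exact: (half_bit_double l.+1 true).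
(* Subtracting half of [pairs] from [degree] gives [n3 + 3 n4]; subtracting twice this from half of
   [pairs] gives [n2 + n3]. By [hd] the differences [3 l - 6] and [3 l - 2] are not truncated. *)
split=> l dl; rewrite dl in hd pairs degree.
  rewrite half oddM /= in degree; split; nia.
rewrite half' oddD oddM /= in degree; split; nia.
Qed.
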